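(* Let $g$ be a totally positive function of finite type $m\ge 2$ and let $a,M\in\mathbb{N}$. Let $Sg=(g(k))_{k\in\mathbb{Z}}$. If $a/M<1$, then the Gabor family $\mathcal{G}(Sg,a,1/M)=\{M_{l/M}T_{ka}Sg: k\in\mathbb{Z},\ l=0,\ldots,M-1\}$ is a frame for $\ell^2(\mathbb{Z})$, and there exists a finitely supported dual window $\gamma\in\ell^2(\mathbb{Z})$ for this frame. If $a/M>1$, then $\mathcal{G}(Sg,a,1/M)$ is a Riesz sequence in $\ell^2(\mathbb{Z})$.
   Context: $j$ is the imaginary unit and $\hat g(\xi)=\int g(x)e^{-2\pi jx\xi}dx$. A function $g\in L^1(\mathbb{R})$ is totally positive of finite type $m\in\mathbb{N}$ if $\hat g(\xi)=C\prod_{k=1}^m(1+2\pi j\delta_k\xi)^{-1}$ with $C>0$ and nonzero real $\delta_k$ (for $m\ge2$ such $g$ is continuous with exponential decay). On $\ell^2(\mathbb{Z})$: $M_\xi T_k f(l)=f(l-k)e^{2\pi j\xi l}$. A family $(e_i)$ in a Hilbert space $H$ is a frame if there are $A,B>0$ with $A\|f\|^2\le\sum_i|\langle f,e_i\rangle|^2\le B\|f\|^2$ for all $f\in H$; it is a Riesz sequence if there are $A',B'>0$ with $A'\|c\|_2^2\le\|\sum_i c_ie_i\|^2\le B'\|c\|_2^2$ for all finitely supported (equivalently all square-summable) coefficient sequences $c$. A dual window for the frame $\mathcal{G}(Sg,a,1/M)$ is $\gamma\in\ell^2(\mathbb{Z})$ such that $\mathcal{G}(\gamma,a,1/M)$ is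 a frame and $f=\sum_{k\in\mathbb{Z}}\sum_{l=0}^{M-1}\langle f,M_{l/M}T_{ka}Sg\rangle M_{l/M}T_{ka}\gamma$ for all $f\in\ell^2(\mathbb{Z})$. *)

(* Defs.v *)
(* mathcomp-analysis (R : realType) + real_closed complex numbers R[i]. *)
From HB Require Import structures.
From mathcomp Require Import all_boot all_order all_algebra.
From mathcomp Require Import all_classical all_reals all_analysis.
From mathcomp Require Import complex.
Set Implicit Arguments. Unset Strict Implicit. Unset Printing Implicit Defensive.
Import Order.TTheory GRing.Theory Num.Theory numFieldNormedType.Exports.
Local Open Scope ring_scope.
Local Open Scope complex_scope.

Section Defs.
Variable R : realType.
Local Notation C := R[i].

(* squared modulus |z|^2 of a complex number *)
Definition sqn (z : C) : R := complex.Re z ^+ 2 + complex.Im z ^+ 2.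

(* e^{j t} *)
Definition expj (t : R) : C := cos t +i* sin t.

(* squared l^2(Z) norm, as an extended real (+oo if f is not in l^2) *)
Definition l2norm2 (f : int -> C) : \bar R := \esum_(n in [set: int]) (sqn (f n))%:E.

(* membership in l^2(Z) *)
Definition in_l2 (f : int -> C) : Prop := (l2norm2 f < +oo)%E.

(* symmetric partial sum  sum_{n=-N}^{N} u n *)
Definition symsum (u : int -> C) (N : nat) : C :=
  \sum_(i < (N + N).+1) u (i%:Z - N%:Z).

(* inner product <f,h> = sum_n f(n) conj(h(n)) on l^2(Z) (absolutely convergent
   for f h in l^2, computed as the limit of symmetric partial sums,
   real and imaginary parts separately) *)
Definition ip (f h : int -> C) : C :=
  limn (fun N : nat => (complex.Re (symsum (fun n => f n * (h n)^*) N) : R^o)) +i*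
  limn (fun N : nat => (complex.Im (symsum (fun n => f n * (h n)^*) N) : R^o)).

(* frame for l^2(Z) *)
Definition is_frame (I : choiceType) (e : I -> int -> C) : Prop :=
  (forall i, in_l2 (e i)) /\
  exists A B : R, 0 < A /\ 0 < B /\
    forall f, in_l2 f ->
      (A%:E * l2norm2 f <= \esum_(i in [set: I]) (sqn (ip f (e i)))%:E)%E /\
      (\esum_(i in [set: I]) (sqn (ip f (e i)))%:E <= B%:E * l2norm2 f)%E.

(* Riesz sequence in l^2(Z): bounds for all finitely supported coefficient
   sequences, i.e. coefficient families c supported on a duplicate-free finite list s *)
Definition is_riesz_seq (I : choiceType) (e : I -> int -> C) : Prop :=
  (forall i, in_l2 (e i)) /\
  exists A B : R, 0 < A /\ 0 < B /\
    forall (s : seq I) (c : I -> C), uniq s ->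
      (A%:E * (\sum_(i <- s) sqn (c i))%:E
         <= l2norm2 (fun n => (\sum_(i <- s) c i * e i n)%R))%E /\
      (l2norm2 (fun n => (\sum_(i <- s) c i * e i n)%R)
         <= B%:E * (\sum_(i <- s) sqn (c i))%:E)%E.

(* Gabor system G(h, a, 1/M) on l^2(Z): elements M_{l/M} T_{ka} h,
   (M_xi T_k f)(n) = f(n - k) e^{2 pi j xi n} *)
Definition gabor (h : int -> C) (a M : nat) (kl : int * 'I_M) : int -> C :=
  fun n => h (n - kl.1 * a%:Z) * expj (2 * pi * (kl.2%:R / M%:R) * n%:~R).
Arguments gabor h a M kl : clear implicits.

(* gamma is a dual window for the frame G(h, a, 1/M): G(gamma,a,1/M) is a frame and
   f = sum_{k in Z} sum_{l<M} <f, M_{l/M}T_{ka} h> M_{l/M}T_{ka} gamma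
   for all f in l^2(Z), the series over k converging in l^2(Z) norm
   (symmetric partial sums over |k| <= K) *)
Definition dual_window (h gamma : int -> C) (a M : nat) : Prop :=
  is_frame (gabor gamma a M) /\
  forall f, in_l2 f ->
    forall eps : R, 0 < eps -> exists K0 : nat, forall K : nat, (K0 <= K)%N ->
      (l2norm2 (fun n => (f n -
          symsum (fun k => \sum_(l < M) ip f (gabor h a M (k, l)) * gabor gamma a M (k, l) n) K)%R)
        <= eps%:E)%E.

(* Fourier transform hat g(xi) = int g(x) e^{-2 pi j x xi} dx of a real-valued g *)
Definition fourier (g : R -> R) (xi : R) : C :=
  Rintegral lebesgue_measure setT (fun x => g x * cos (2 * pi * x * xi)) +i*
  (- Rintegral lebesgue_measure setT (fun x => g x * sin (2 * pi * x * xi))).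

(* g in L^1(R) is totally positive of finite type m *)
Definition totally_positive_finite_type (g : R -> R) (m : nat) : Prop :=
  lebesgue_measure.-integrable setT (EFin \o g) /\
  exists (Cst : R) (delta : 'I_m -> R),
    0 < Cst /\ (forall k, delta k != 0) /\
    forall xi, fourier g xi =
      Cst%:C * \prod_(k < m) (1 + (2 * pi * delta k * xi)%:C * 'i)^-1.

End Defs.
Arguments gabor {R} h a M kl.

(* Main.v *)
Require Import Defs.
From HB Require Import structures.
From mathcomp Require Import all_boot all_order all_algebra.
From mathcomp Require Import all_classical all_reals all_analysis.
From mathcomp Require Import complex measurable_realfun.
From mathcomp Require Import zify ring lra.
Import Order.TTheory GRing.Theory Num.Theory numFieldNormedType.Exports.
Local Open Scope ring_scope.
Local Open Scope complex_scope.
Set Implicit Arguments.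
Unset Strict Implicit.
Unset Printing Implicit Defensive.

(* Solving G + delta_i G' = G_{i-1} successively among piecewise exponential polynomials yields a
   decaying function with the same Fourier transform as g, which is therefore g; so g is glued from
   exponential polynomials at 0, and a combination f of the g(. - kM) is an exponential spline with
   knots in MZ. When a < M, the sampling points x + ja are denser than the knots, and Rolle's
       theorem
   shows that an f vanishing at sufficiently many consecutive ones has zero coefficients at the
       inner
   knots. Finite linear algebra turns this into a finitely supported solution of the Wexler-Raz
   equations sum_k g(n + pM - ka) gamma(n - ka) = delta_{p,0} / M, which gives the dual window for
   a < M. With the roles of a and M exchanged the same solution is biorthogonal to the Gabor system,
   which gives the Riesz bounds for a > M. All upper bounds come from Schur's test, the samples of g
   being summable. *)

(** * Zeros of exponential splines *)

(** The Wexler-Raz equations form an infinite system, one equation for each p and each residue of n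
    modulo a, and a finitely supported window offers finitely many unknowns. The translates of g
    have unbounded support, so no equation drops out for trivial reasons. By duality, however, a
    solution exists as soon as every finite linear relation between the sampled translates has
    coefficient 0 at the translate p = 0. That coefficient is a local quantity: at the bottom of the
    ladder it is, up to a nonzero factor, the height of the jump at the knot 0, so it is enough that
    f vanishes on [-M, M].

    Descending to the bottom costs a number of sign changes that depends on m only, whereas the
    surplus of Z zeros over about Z a / M knots grows with Z; a long enough window of samples
    therefore decides.

    Since the dual window is finitely supported, reconstruction at a given point and biorthogonality
    are identities between finite sums, and limits enter only through inner products and norm
    bounds. *)

Section Zeros.
Variable R : realType.
Implicit Types (K : R -> Prop) (H F : R -> R).

Lemma mvt_exc K H H' (s t : R) (r : seq R) : s < t ->
  (forall x, s <= x <= t -> {for x, continuous H}) ->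
  (forall x, s < x < t -> ~ K x -> is_derive x 1 H (H' x)) ->
  (forall x, s < x < t -> K x -> x \in r) ->
  H s < H t -> exists u, [/\ s < u < t, ~ K u & 0 < H' u].
Proof.
have [n] := ubnP (size r); elim: n => // n IH in r s t *.
rewrite ltnS => rn st cH dH Kr Hst.
have [[x [/andP[sx xt] Kx]]|noK] := pselect (exists x, s < x < t /\ K x).
  have xr : x \in r by apply: Kr => //; rewrite sx xt.
  have sz : (size (seq.filter (predC1 x) r) < n)%N.
    apply: leq_trans rn; rewrite size_filter.
    rewrite -(count_predC (predC1 x) r) -[X in (X < _)%N]addn0 ltn_add2l -has_count.
    by apply/hasP; exists x => //=; rewrite eqxx.
  have [Hsx|Hxs] := ltP (H s) (H x).
    have [||y /andP[sy yx] Ky|u [/andP[su ux] Ku H'u]] := IH _ s x sz sx _ _ _ Hsx.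
    - by move=> y /andP[sy yx]; apply: cH; rewrite sy (le_trans yx (ltW xt)).
    - by move=> y /andP[sy yx]; apply: dH; rewrite sy (lt_trans yx xt).
    - by rewrite mem_filter/= lt_eqF//= Kr// sy (lt_trans yx xt).
    by exists u; rewrite su (lt_trans ux xt).
  have Hxt := le_lt_trans Hxs Hst.
  have [||y /andP[sy yx] Ky|u [/andP[su ux] Ku H'u]] := IH _ x t sz xt _ _ _ Hxt.
  - by move=> y /andP[sy yx]; apply: cH; rewrite yx (le_trans (ltW sx) sy).
  - by move=> y /andP[sy yx]; apply: dH; rewrite yx (lt_trans sx sy).
  - by rewrite mem_filter/= gt_eqF//= Kr// yx (lt_trans sx sy).
  by exists u; rewrite ux (lt_trans sx su).
have nK x : s < x < t -> ~ K x by move=> sxt Kx; apply: noK; exists x.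
have [x||c] := @MVT _ H H' _ _ st.
- by rewrite in_itv/= => xst; apply: dH => //; exact: nK.
  apply: continuous_in_subspaceT => x; rewrite inE/= in_itv/= => xst; exact: cH.
rewrite in_itv/= => cst E.
exists c; split => //; first exact: nK.
by move: Hst; rewrite -subr_gt0 E pmulr_lgt0// subr_gt0.
Qed.

(** The integrating factor: where F + d F' = v, the derivative of [mulexp d F] is e^(t/d) v / d. Its
    monotonicity is thus read off the signs of v and d, while its own sign is that of F. *)
Definition mulexp (d : R) F := fun t => expR (t / d) * F t.

Lemma is_derive_mulexp (d : R) F (x v : R) : d != 0 -> is_derive x 1 F ((v - F x) / d) ->
  is_derive x 1 (mulexp d F) (expR (x / d) * v / d).
Proof.
move=> d0 dF.
have dE : is_derive x 1 (fun t => expR (t / d)) (expR (x / d) / d).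
  have -> : (fun t => expR (t / d)) = expR \o (d^-1 \*: (@idfun R)).
    by apply/funext => y /=; rewrite mulrC.
  apply: is_derive_eq; rewrite /= /GRing.scale/= mulr1 mulrC.
  by rewrite mulrC; congr (expR _ * _); rewrite mulrC.
apply: is_derive_eq; rewrite /GRing.scale/=; field.
by [].
Qed.

Lemma continuous_mulexp (d : R) F (x : R) : {for x, continuous F} -> {for x, continuous (mulexp d
    F)}.
Proof.
move=> cF; apply: cvgM => //.
apply: continuous_comp; last exact: continuous_expR.
by apply: cvgM => //; exact: cvg_cst.
Qed.

(* Off the knots [K], [F i = F i.+1 + d i * (F i.+1)']: each rung removes one factor of the
   differential operator that annihilates [F n] off [K]. *)
Record ladder K (d : nat -> R) (F : nat -> R -> R) (n : nat) : Prop := Ladder {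
  ladder_d : forall i, d i != 0;
  ladder0 : F 0%N = cst 0;
  ladder_cont : forall i, (i.+2 <= n)%N -> continuous (F i.+2);
  ladder_deriv : forall i, (i < n)%N -> forall x, ~ K x ->
    is_derive x 1 (F i.+1) ((F i x - F i.+1 x) / d i) }.

Definition locally_finite K :=
  forall s t : R, exists r : seq R, forall x, s < x < t -> K x -> x \in r.

(* [e] carries the sign of the first of the [S] values. *)
Definition alternates K F (S : nat) (al be : R) := exists (e : R) (t : nat -> R),
  (forall i, (i < S)%N -> [/\ al < t i < be, ~ K (t i) & 0 < e * (-1) ^+ i * F (t i)]) /\
  (forall i, (i.+1 < S)%N -> t i < t i.+1).

Section Ladder.
Variables (K : R -> Prop) (d : nat -> R) (F : nat -> R -> R) (n : nat).
Hypotheses (finK : locally_finite K) (lad : ladder K d F n).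

Lemma mulexp_gt0 (dd e : R) H (x : R) : (0 < e * mulexp dd H x) = (0 < e * H x).
Proof. by rewrite /mulexp mulrCA pmulr_rgt0 ?expR_gt0. Qed.

Lemma ladder_rise i (e s t : R) : (i.+2 <= n)%N -> s < t ->
  e * mulexp (d i.+1) (F i.+2) s < e * mulexp (d i.+1) (F i.+2) t ->
  exists u, [/\ s < u < t, ~ K u & 0 < e * d i.+1 * F i.+1 u].
Proof.
move=> ilen st Est; have [r rP] := finK s t.
have d0 := ladder_d lad i.+1.
have [x _|x _ Kx|||u [sut Ku]] := @mvt_exc K (fun x => e * mulexp (d i.+1) (F i.+2) x)
  (fun x => e * (expR (x / d i.+1) * F i.+1 x / d i.+1)) _ _ r st.
- apply: cvgM; first exact: cvg_cst.
  by apply: continuous_mulexp; exact: (ladder_cont lad).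
- have := is_derive_mulexp d0 (ladder_deriv lad ilen Kx).
  move=> dE; have := @is_deriveZ _ _ _ _ e _ _ _ dE; exact.
- exact: rP.
- exact: Est.
- move=> /= h; exists u; split => //; move: h.
  have -> : e * (expR (u / d i.+1) * F i.+1 u / d i.+1) =
    (expR (u / d i.+1) / (d i.+1) ^+ 2) * (e * d i.+1 * F i.+1 u) by field.
  by rewrite pmulr_rgt0// divr_gt0 ?expR_gt0// exprn_even_gt0.
Qed.

Lemma alternates_rise i S (e : R) (t : nat -> R) : (i.+2 <= n)%N ->
  (forall j, (j < S)%N -> t j < t j.+1) ->
  (forall j, (j < S)%N -> e * (-1) ^+ j * mulexp (d i.+1) (F i.+2) (t j) <
                          e * (-1) ^+ j * mulexp (d i.+1) (F i.+2) (t j.+1)) ->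
  alternates K (F i.+1) S (t 0%N) (t S).
Proof.
move=> ilen tinc Einc.
have /choice[u uP] : forall j, exists u, (j < S)%N ->
    [/\ t j < u < t j.+1, ~ K u & 0 < e * (-1) ^+ j * d i.+1 * F i.+1 u].
  move=> j; have [jS|_] := boolP (j < S)%N; last by exists 0.
  by have [u uP] := ladder_rise ilen (tinc _ jS) (Einc _ jS); exists u.
have tle p q : (p <= q)%N -> (q <= S)%N -> t p <= t q.
  move=> pq; rewrite -(subnKC pq); elim: (q - p)%N => [|k IH kS]; first by rewrite addn0.
  rewrite (le_trans (IH _))//; first by apply: leq_trans kS; rewrite addnS.
  by rewrite addnS ltW// tinc// -addnS.
exists (e * d i.+1), u; split => [j jS|j jS].
  have [/andP[h1 h2] Ku h3] := uP j jS; split => //; last by rewrite [e * d _ * _]mulrAC.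
  by rewrite (le_lt_trans (tle _ _ _ _) h1) ?(ltnW jS)// (lt_le_trans h2 (tle _ _ _ _)).
have [/andP[_ h1] _ _] := uP j (ltnW jS); have [/andP[h2 _] _ _] := uP j.+1 jS.
exact: lt_trans h1 h2.
Qed.

(** Rolle's theorem in terms of signs: S + 1 alternating values bound S gaps, over which the
    weighted function falls and rises in turn. One value is lost. *)
Lemma alternates_step i S (al be : R) : (i.+2 <= n)%N ->
  alternates K (F i.+2) S.+1 al be -> alternates K (F i.+1) S al be.
Proof.
move=> ilen [e [t [tP tinc]]].
have [||e' [u [uP uinc]]] := @alternates_rise i S (- e) t ilen.
- by move=> j jS; exact: tinc.
- move=> j jS; have [_ _ h1] := tP j (ltnW jS); have [_ _ h2] := tP j.+1 jS.
  apply: (@lt_trans _ _ 0).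
    by rewrite mulNr mulNr oppr_lt0 mulexp_gt0.
  by rewrite mulexp_gt0; move: h2; rewrite exprS mulN1r mulrN !mulNr.
exists e', u; split => // j jS; have [/andP[u1 u2] Ku h] := uP j jS; split => //.
have [/andP[al1 _] _ _] := tP 0%N isT; have [/andP[_ be1] _ _] := tP S (leqnn _).
by rewrite (lt_trans al1 u1) (lt_trans u2 be1).
Qed.

(** The zero at the left end bounds one more gap, so that no value is lost on the way down. *)
Lemma alternates_step0 i S (al be : R) : (i.+2 <= n)%N -> F i.+2 al = 0 ->
  alternates K (F i.+2) S.+1 al be -> alternates K (F i.+1) S.+1 al be.
Proof.
move=> ilen Fal [e [t [tP tinc]]].
have E0 : mulexp (d i.+1) (F i.+2) al = 0 by rewrite /mulexp Fal mulr0.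
pose t' j := if j is k.+1 then t k else al.
have [||e' [u [uP uinc]]] := @alternates_rise i S.+1 e t' ilen.
- by case => [_|j jS]/=; [have [/andP[]] := tP 0%N isT|exact: tinc].
- case => [_|j jS]/=; first by rewrite E0 mulr0 mulexp_gt0; have [] := tP 0%N isT.
  have [_ _ h1] := tP j (ltnW jS); have [_ _ h2] := tP j.+1 jS.
  apply: (@lt_trans _ _ 0); last by rewrite mulexp_gt0.
  by rewrite exprS mulN1r mulrN mulNr oppr_lt0 mulexp_gt0.
exists e', u; split => // j jS; have [/andP[u1 u2] Ku h] := uP j jS; split => //.
by rewrite u1/=; apply: lt_trans u2 _; have [/andP[]] := tP S (leqnn _).
Qed.

(** In each gap the weighted function leaves 0 and returns to it, so it both rises and falls. The
    rung below takes both signs there, and the sign can be prescribed gap by gap. *)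
Lemma zeros_alternate i (z : nat -> R) S : n = i.+2 ->
  (forall j, (j < S)%N -> z j < z j.+1) ->
  (forall j, (j <= S)%N -> F n (z j) = 0) ->
  (forall j, (j < S)%N -> exists2 y, z j < y < z j.+1 & F n y != 0) ->
  alternates K (F i.+1) S (z 0%N) (z S).
Proof.
move=> nE zinc z0 zn0.
have /choice[u uP] : forall j, exists u, (j < S)%N ->
    [/\ z j < u < z j.+1, ~ K u & 0 < (-1) ^+ j * d i.+1 * F i.+1 u].
  move=> j; have [jS|_] := boolP (j < S)%N; last by exists 0.
  have [y /andP[y1 y2] Fy] := zn0 _ jS.
  have ilen : (i.+2 <= n)%N by rewrite nE.
  have E0 k : (k <= S)%N -> mulexp (d i.+1) (F i.+2) (z k) = 0.
    by move=> kS; rewrite /mulexp -nE z0// mulr0.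
  (* After multiplication by (-1)^j, the weighted function rises either from z j to y or from y to z
     (j + 1). *)
  have [h|h] := ltP 0 ((-1) ^+ j * mulexp (d i.+1) (F i.+2) y).
    have [|u [/andP[u1 u2] Ku uF]] := @ladder_rise i ((-1) ^+ j) _ _ ilen y1.
      by rewrite E0 ?mulr0// ltnW.
    by exists u; rewrite u1 (lt_trans u2 y2).
  have [|u [/andP[u1 u2] Ku uF]] := @ladder_rise i ((-1) ^+ j) _ _ ilen y2.
    rewrite (E0 j.+1)// mulr0 lt_neqAle h andbT; apply: mulf_neq0; first by rewrite signr_eq0.
    by apply: mulf_neq0; [rewrite gt_eqF ?expR_gt0|move: Fy; rewrite nE].
  by exists u; rewrite u2 (lt_trans y1 u1).
have zle p q : (p <= q)%N -> (q <= S)%N -> z p <= z q.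
  move=> pq; rewrite -(subnKC pq); elim: (q - p)%N => [|k IH kS]; first by rewrite addn0.
  rewrite (le_trans (IH _))//; first by apply: leq_trans kS; rewrite addnS.
  by rewrite addnS ltW// zinc// -addnS.
exists (d i.+1), u; split => [j jS|j jS].
  have [/andP[h1 h2] Ku h3] := uP j jS; split => //; last by rewrite [d _ * _]mulrC.
  by rewrite (le_lt_trans (zle _ _ _ _) h1) ?(ltnW jS)// (lt_le_trans h2 (zle _ _ _ _)).
have [/andP[_ h1] _ _] := uP j (ltnW jS); have [/andP[h2 _] _ _] := uP j.+1 jS.
exact: lt_trans h1 h2.
Qed.

(** As [F 0] vanishes, [F 1] solves the homogeneous equation: between knots it is a multiple of
    e^(-t / d 0). *)
Lemma ladder1_cst (s t : R) : (0 < n)%N -> s <= t -> (forall x, s <= x <= t -> ~ K x) ->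
  mulexp (d 0%N) (F 1%N) s = mulexp (d 0%N) (F 1%N) t.
Proof.
move=> n0 st nK; have d0 := ladder_d lad 0%N.
have dE x : s <= x <= t -> is_derive x 1 (mulexp (d 0%N) (F 1%N)) 0.
  move=> sxt; have := is_derive_mulexp d0 (ladder_deriv lad n0 (nK x sxt)).
  by rewrite (ladder0 lad) /= mulr0 mul0r.
move: st; rewrite le_eqVlt => /predU1P[->//|st].
have [x||c _] := @MVT _ (mulexp (d 0%N) (F 1%N)) (fun=> 0) _ _ st.
- by rewrite in_itv/= => /andP[sx xt]; apply: dE; rewrite !ltW.
- apply: continuous_in_subspaceT => x; rewrite inE/= in_itv/= => sxt.
  by apply/differentiable_continuous/derivable1_diffP; have [] := dE x sxt.
- by rewrite mul0r => /subr0_eq ->.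
Qed.
End Ladder.

Definition knots (M : nat) (x : R) := exists k : int, x = k%:~R * M%:R.

Lemma sign_change_knot (M : nat) (d : nat -> R) (F : nat -> R -> R) (n : nat) (e s t : R) :
  (0 < n)%N -> ladder (knots M) d F n -> s < t -> ~ knots M s -> ~ knots M t ->
  0 < e * F 1%N s -> e * F 1%N t < 0 -> exists k : int, s < k%:~R * M%:R < t.
Proof.
move=> n0 lad st Ks Kt h1 h2; apply: contrapT => no.
have nK x : s <= x <= t -> ~ knots M x.
  move=> /andP[]; rewrite !le_eqVlt => /predU1P[<-//|x1] /predU1P[->//|x2] [k xE].
  by apply: no; exists k; rewrite -xE x1.
have E := ladder1_cst lad n0 (ltW st) nK.
move: h1; rewrite -(mulexp_gt0 (d 0%N)) E mulexp_gt0 => /(lt_trans h2).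
by rewrite ltxx.
Qed.

Lemma knot_gap (M : nat) (x y : R) : knots M x -> knots M y -> x < y -> x + M%:R <= y.
Proof.
move=> [k ->] [k' ->] kk'.
have M0 : 0 < M%:R :> R by case: (M) kk' => [|//]; rewrite !mulr0 ltxx.
have : k + 1 <= k' by rewrite lezD1 -(ltr_int R) -(ltr_pM2r M0).
rewrite -(ler_int R) rmorphD/= => kk1.
by rewrite -[X in _ + X]mul1r -mulrDl ler_wpM2r.
Qed.

(** S + 2 alternating values have S + 1 sign changes, each with a knot of its own; the first and the
    last of these knots are at least S M apart. *)
Lemma alternates_knots (M : nat) (d : nat -> R) (F : nat -> R -> R) (n S : nat) (al be : R) : (0 <
    n)%N -> ladder (knots M) d F n ->
  alternates (knots M) (F 1%N) S.+2 al be -> S%:R * M%:R < be - al.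
Proof.
move=> n0 lad [e [t [tP tinc]]].
have kn i : (i <= S)%N -> exists k : int, t i < k%:~R * M%:R < t i.+1.
  move=> iS; have [_ K1 h1] := tP i (leqW iS); have [_ K2 h2] := tP i.+1 iS.
  apply: (@sign_change_knot M d F n (e * (-1) ^+ i)) => //; first exact: tinc.
  by move: h2; rewrite exprS mulN1r mulrN mulNr oppr_gt0.
have ind i : (i <= S)%N -> exists k : int, t 0%N + i%:R * M%:R < k%:~R * M%:R < t i.+1.
  elim: i => [_|i IH iS]; first by rewrite mul0r addr0; exact: kn.
  have [k /andP[k1 k2]] := IH (ltnW iS); have [k' /andP[k1' k2']] := kn _ iS.
  exists k'; rewrite k2' andbT -natr1 mulrDl mul1r addrA.
  apply: (@lt_le_trans _ _ (k%:~R * M%:R + M%:R)); first by rewrite ltrD2r.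
  by apply: knot_gap; [exists k|exists k'|exact: lt_trans k2 k1'].
have [k /andP[k1 k2]] := ind S (leqnn S).
have [/andP[h1 _] _ _] := tP 0%N isT; have [/andP[_ h2] _ _] := tP S.+1 (leqnn _).
have := lt_trans k1 k2; lra.
Qed.
End Zeros.

Section Zeros2.
Variable R : realType.
Implicit Types (K : R -> Prop) (d : nat -> R) (F : nat -> R -> R).

(** Each rung is a combination of the rung above and its derivative, so vanishing on an open
    interval is inherited downwards. *)
Lemma ladder_zero_down K d F n (p q : R) : ladder K d F n ->
  (forall x, p < x < q -> ~ K x) -> (forall x, p < x < q -> F n x = 0) ->
  forall i, (i <= n)%N -> forall x, p < x < q -> F i x = 0.
Proof.
move=> lad nK F0.
suff H j : (j <= n)%N -> forall x, p < x < q -> F (n - j)%N x = 0.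
  by move=> i ilen; rewrite -(subKn ilen); apply: H; exact: leq_subr.
elim: j => [|j IH jn x pxq]; first by rewrite subn0.
have {}IH := IH (ltnW jn).
have E : (n - j = (n - j.+1).+1)%N by rewrite -subSn// subSS.
rewrite E in IH.
have lt : (n - j.+1 < n)%N by rewrite ltn_subrL/= (leq_trans _ jn).
have dF := ladder_deriv lad lt (nK _ pxq).
have d0 : is_derive x 1 (F (n - j.+1).+1) 0.
  apply: (near_eq_is_derive _ (is_derive_cst (0 : R) x 1)).
  have : \forall y \near x, y \in `]p, q[ by apply: near_in_itvoo; rewrite in_itv.
  apply: filterS => y; rewrite in_itv/= => pyq; by rewrite IH.
have := @derive_val _ _ _ _ _ _ _ dF; rewrite (@derive_val _ _ _ _ _ _ _ d0).
move/esym/eqP; rewrite mulf_eq0 invr_eq0 (negPf (ladder_d lad _)) orbF subr_eq0 => /eqP->.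
exact: IH.
Qed.

Lemma continuous_zero_left (f : R -> R) (p z : R) : p < z -> {for z, continuous f} ->
  (forall x, p < x < z -> f x = 0) -> f z = 0.
Proof.
move=> pz cf f0; apply/eqP; apply: contrapT => /negP fz.
have /cf : nbhs (f z) (fun y : R => y != 0).
  by apply: open_nbhs_nbhs; split => //; exact: open_neq.
move=> /nbhs_ballP[e /= e0 He].
pose y := Num.max ((p + z) / 2) (z - e / 2).
have y1 : p < y by rewrite lt_max; apply/orP; left; lra.
have y2 : y < z by rewrite gt_max; apply/andP; split; lra.
have y3 : z - e / 2 <= y by rewrite le_max lexx orbT.
have : f y != 0 by apply: He; rewrite /ball/= ltr_distlC; apply/andP; split; lra.
by rewrite f0 ?y1// eqxx.
Qed.

Lemma knots_locally_finite M : (0 < M)%N -> locally_finite (@knots R M).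
Proof.
move=> M0 s t; have M0' : 0 < M%:R :> R by rewrite ltr0n.
pose N := Num.bound (`|s| + `|t|).
exists [seq (i%:Z - N%:Z)%:~R * M%:R | i <- iota 0 (N + N).+1].
move=> x /andP[sx xt] [k xE].
have kN : `|k%:~R| < N%:R :> R.
  have : `|s| + `|t| < N%:R by apply: archi_boundP; rewrite addr_ge0.
  apply: le_lt_trans.
  have : `|x| <= `|s| + `|t|.
    rewrite ler_norml; apply/andP; split.
      by have := ler_norm (- s); rewrite normrN; have := normr_ge0 t; lra.
    by have := ler_norm t; have := normr_ge0 s; lra.
  apply: le_trans; rewrite xE normrM (ger0_norm (ltW M0')) ler_peMr//.
  by rewrite ler1n.
have {}kN : (`|k| < N%:Z)%R by rewrite -(ltr_int R) intr_norm.
apply/mapP; exists (absz (k + N%:Z)); first by rewrite mem_iota; lia.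
by rewrite xE; congr (_%:~R * _); lia.
Qed.

(* [F 1] is exponential between knots, and [z, w) contains at most one knot: this leaves no room
   for the sign change of [F 1] that a nonzero [F n.+2] would produce on (z, w). *)
Lemma ladder_spread (M : nat) d F n (z' z w : R) : (0 < M)%N -> ladder (knots M) d F n.+2 ->
  z' < z -> z < w -> z - z' <= M%:R -> w - z <= M%:R ->
  (forall x, z' < x < z -> F n.+2 x = 0) -> F n.+2 w = 0 ->
  forall x, z < x < w -> F n.+2 x = 0.
Proof.
move=> M0 lad zz' zw zM wM F0 Fw y /andP[zy yw].
have finK := knots_locally_finite M0.
(* As z - z' <= M, at most one knot lies in (z', z); if there is one, it is taken for z2. *)
have [z2 [z2z z'z2 nK]] : exists z2, [/\ z2 < z, z' <= z2 & forall x, z2 < x < z -> ~ knots M x].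
  have [[k [/andP[h1 h2] Kk]]|no] := pselect (exists k, z' < k < z /\ knots M k).
    exists k; split => //; first exact: ltW.
    by move=> x /andP[kx xz] Kx; have := knot_gap Kk Kx kx; lra.
  by exists z'; split => // x h Kx; apply: no; exists x.
have {}F0 x : z2 < x < z -> F n.+2 x = 0.
  by move=> /andP[h1 h2]; apply: F0; rewrite h2 (le_lt_trans z'z2 h1).
have {}F0 := ladder_zero_down lad nK F0.
have Fz i : (i.+2 <= n.+2)%N -> F i.+2 z = 0.
  move=> ilen; apply: (continuous_zero_left z2z); first exact: (ladder_cont lad).
  exact: F0.
apply/eqP; apply: contrapT => /negP Fy.
(* The top rung is 0 at z, nonzero at y and 0 at w, which gives two signs on the next rung; the
   zeros at z of the rungs from 2 upwards carry both signs down to [F 1]. *)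
have alt j : (j <= n)%N -> alternates (knots M) (F (n - j).+1) 2 z w.
  elim: j => [_|j IH jn]; last first.
    have {}IH := IH (ltnW jn); have E : (n - j = (n - j.+1).+1)%N by rewrite -subSn// subSS.
    apply: (alternates_step0 finK lad); last by rewrite -E.
      by lia.
    by apply: Fz; lia.
  rewrite subn0.
  pose t (j : nat) := if j == 0%N then z else if j == 1%N then y else w.
  apply: (@alternates_rise R _ _ _ _ finK lad n 2 (F n.+2 y) t) => //.
    by case => [|[|]].
  case => [|[|//]] _ /=; rewrite /t/=.
    have -> : mulexp (d n.+1) (F n.+2) z = 0 by rewrite /mulexp Fz// mulr0.
    by rewrite expr0 mulr1 mulr0 mulexp_gt0 -expr2 exprn_even_gt0.
  have -> : mulexp (d n.+1) (F n.+2) w = 0 by rewrite /mulexp Fw mulr0.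
  by rewrite expr1 mulr0 mulrN1 mulNr oppr_lt0 mulexp_gt0 -expr2 exprn_even_gt0.
have := alt n (leqnn _); rewrite subnn => -[e [t [tP tinc]]].
have [/andP[zt0 t0w] Kt0 h0] := tP 0%N isT.
have [/andP[zt1 t1w] Kt1 h1] := tP 1%N isT.
have t01 := tinc 0%N isT.
have [||k /andP[k1 k2]] := @sign_change_knot R M d F n.+2 e _ _ isT lad t01 Kt0 Kt1.
- by move: h0; rewrite expr0 mulr1.
- by move: h1; rewrite expr1 mulrN1 mulNr oppr_gt0.
pose s := (z2 + z) / 2.
have sz : s < z by rewrite /s; lra.
have z2s : z2 < s by rewrite /s; lra.
(* A knot in [z, t 0] would be less than M away from k, since w - z <= M. Hence [F 1], which is 0
   just left of z, stays 0 up to t 0, against its sign there. *)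
have nK' x : s <= x <= t 0%N -> ~ knots M x.
  move=> /andP[sx xt]; have [xz|zx] := ltP x z; first by apply: nK; rewrite xz (lt_le_trans z2s).
  move=> Kx; have := @knot_gap R M x _ Kx (ex_intro _ k erefl) (le_lt_trans xt k1).
  lra.
have := @ladder1_cst _ _ _ _ _ lad _ _ isT (ltW (lt_trans sz zt0)) nK'.
rewrite {1}/mulexp F0 ?sz ?z2s// mulr0 => /esym E.
by move: h0; rewrite expr0 mulr1 -(mulexp_gt0 (d 0%N)) E mulr0 ltxx.
Qed.

(** Makes [ladder_spread], which works from left to right, available in the other direction. *)
Lemma ladder_reflect (M : nat) d F n : ladder (knots M) d F n ->
  ladder (knots M) (fun i => - d i) (fun i x => F i (- x)) n.
Proof.
move=> lad; split => [i|||i ilen x Kx].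
- by rewrite oppr_eq0 (ladder_d lad).
- by rewrite (ladder0 lad).
- move=> i ilen x; apply: continuous_comp; first exact: opp_continuous.
  exact: (ladder_cont lad).
- have Kx' : ~ knots M (- x).
    by move=> [k xE]; apply: Kx; exists (- k); rewrite rmorphN/= mulNr -xE opprK.
  have dF := ladder_deriv lad ilen Kx'.
  have := @is_derive1_comp _ (F i.+1) -%R x _ _ dF (@is_deriveNid _ _ x 1).
  by rewrite mulrN1 invrN mulrN.
Qed.

(* If [F n.+2] vanishes on no interval between consecutive zeros, Rolle's theorem leaves about
   [Z - n] sign changes for [F 1], each of which needs a knot; but there are only about
   [Z * a / M] knots. Hence it vanishes on one interval, and then on all by [ladder_spread]. *)
Lemma ladder_window (M a n Z : nat) d F (x : R) :
  (0 < a < M)%N -> (n.+2 * M + Z * a <= Z * M)%N -> ladder (knots M) d F n.+2 ->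
  (forall j, (j <= Z)%N -> F n.+2 (x + j%:R * a%:R) = 0) ->
  forall y, x <= y <= x + Z%:R * a%:R -> F n.+2 y = 0.
Proof.
move=> /andP[a0 aM] ZP lad Fz.
pose z (j : nat) := x + j%:R * a%:R.
have M0 : (0 < M)%N by exact: leq_ltn_trans aM.
have a0' : 0 < a%:R :> R by rewrite ltr0n.
have zS j : z j.+1 = z j + a%:R by rewrite /z -natr1; ring.
have aM' : a%:R <= M%:R :> R by rewrite ler_nat ltnW.
have [j0 j0Z Fj0] : exists2 j, (j < Z)%N & forall y, z j < y < z j.+1 -> F n.+2 y = 0.
  apply: contrapT => no.
  have alt : alternates (knots M) (F n.+1) Z (z 0%N) (z Z).
    apply: (zeros_alternate (knots_locally_finite M0) lad) => // j jZ.
      by rewrite zS; lra.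
    apply: contrapT => no'; apply: no; exists j => // y yP; apply/eqP; apply: contrapT => /negP Fy.
    by apply: no'; exists y.
  have nZ : (n.+2 <= Z)%N.
    rewrite -(@leq_pmul2r M)//; apply: leq_trans ZP; exact: leq_addr.
  have {}alt j : (j <= n)%N -> alternates (knots M) (F (n - j).+1) (Z - j) (z 0%N) (z Z).
    elim: j => [_|j IH jn]; first by rewrite !subn0.
    have {}IH := IH (ltnW jn); have E : (n - j = (n - j.+1).+1)%N by rewrite -subSn// subSS.
    apply: (alternates_step (knots_locally_finite M0) lad).
      by lia.
    by rewrite -E; move: IH; congr (alternates _ _ _ _ _); lia.
  (* The Z - n alternating values of [F 1] force (Z - n - 2) M < Z a, which is the negation of the
     hypothesis on Z. *)
  have := alt n (leqnn n); rewrite subnn.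
  have -> : (Z - n = (Z - n.+2).+2)%N by lia.
  move=> /(alternates_knots (ltn0Sn _) lad).
  rewrite /z mul0r addr0 addrAC subrr add0r -!natrM ltr_nat mulnBl; lia.
have right j : (j0 <= j)%N -> (j < Z)%N -> forall y, z j < y < z j.+1 -> F n.+2 y = 0.
  move=> /subnKC <-; elim: (j - j0)%N => [|k IH]; first by rewrite addn0.
  rewrite addnS => kZ; apply: (ladder_spread M0 lad _ _ _ _ (IH (ltnW kZ)));
    rewrite ?zS; try lra.
  by rewrite -!zS; exact: Fz.
have left j : (j <= j0)%N -> forall y, z j < y < z j.+1 -> F n.+2 y = 0.
  move=> /subKn <-; elim: (j0 - j)%N => [|k IH]; first by rewrite subn0.
  have [kj|kj] := ltnP k j0; last first.
    have -> : (j0 - k.+1 = j0 - k)%N by lia.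
    exact: IH.
  have E : (j0 - k = (j0 - k.+1).+1)%N by lia.
  rewrite E in IH => y /andP[y1 y2].
  rewrite -(opprK y).
  apply: (@ladder_spread M _ _ n (- z (j0 - k.+1).+2) (- z (j0 - k.+1).+1) (- z (j0 - k.+1)%N)
    M0 (ladder_reflect lad)); rewrite ?zS; try lra.
  - by move=> t /andP[t1 t2]; apply: IH; rewrite !zS; apply/andP; split; lra.
  - by rewrite opprK; apply: Fz; lia.
  - by rewrite zS in y2; apply/andP; split; lra.
have all j : (j < Z)%N -> forall y, z j < y < z j.+1 -> F n.+2 y = 0.
  by move=> jZ; have [/left//|/ltnW/right] := leqP j j0; exact.
suff H k : (k <= Z)%N -> forall y, x <= y <= z k -> F n.+2 y = 0 by exact: H.
elim: k => [_ y|k IH kZ y /andP[xy yz]].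
  rewrite /z mul0r addr0 => xyx; have -> : y = x + 0%:R * a%:R by lra.
  exact: Fz.
have [yk|ky] := leP y (z k); first by apply: IH; [exact: ltnW|rewrite xy].
move: yz; rewrite le_eqVlt => /predU1P[->|yz]; first exact: Fz.
by apply: all kZ _ _; rewrite ky.
Qed.
End Zeros2.

(** * Finite sums and finite linear algebra *)

Lemma eq_big_support (T : eqType) (V : nmodType) (s1 s2 : seq T) (F : T -> V) :
  uniq s1 -> uniq s2 -> (forall x, F x != 0 -> (x \in s1) = (x \in s2)) ->
  \sum_(x <- s1) F x = \sum_(x <- s2) F x.
Proof.
move=> u1 u2 H.
have E s : \sum_(x <- s) F x = \sum_(x <- seq.filter (fun x => F x != 0) s) F x.
  by rewrite big_filter [RHS]big_mkcond/=; apply: eq_bigr => x _; case: eqP.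
rewrite E [RHS]E; apply: perm_big; apply: uniq_perm; rewrite ?filter_uniq// => x.
by rewrite !mem_filter; case: eqP => //= /eqP /H.
Qed.

Definition zrange (N : nat) : seq int := [seq i%:Z - N%:Z | i <- iota 0 (N + N).+1].

Lemma mem_zrange N (k : int) : (k \in zrange N) = (`|k| <= N%:Z).
Proof.
apply/mapP/idP => [[j]|kN]; first by rewrite mem_iota => ? ->; lia.
by exists (absz (k + N%:Z)); [rewrite mem_iota|]; lia.
Qed.

Lemma zrange_uniq N : uniq (zrange N).
Proof. by rewrite map_inj_uniq ?iota_uniq// => i j; lia. Qed.

(** The family may be infinite, but ranks are at most N, so some finite [s] without x0 has maximal
    rank. Its span W contains every u k with k <> x0, while u x0 is outside W by independence. A
    column of the cokernel of W that does not kill u x0, suitably scaled, is the required vector. *)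
Lemma dual_vector (F : fieldType) (T : choiceType) (N : nat) (u : T -> 'rV[F]_N) (x0 : T) :
  (forall s c, uniq s -> \sum_(k <- s) c k *: u k = 0 -> x0 \in s -> c x0 = 0) ->
  exists v : 'cV[F]_N, forall k, (u k *m v) ord0 ord0 = (k == x0)%:R.
Proof.
move=> indep.
pose W s := (\sum_(k <- s) <<u k>>)%MS.
pose P r := `[< exists s, [/\ uniq s, x0 \notin s & \rank (W s) = r] >].
have exP : exists r, P r by exists (\rank (W [::])); apply/asboolP; exists [::].
have Pub r : P r -> (r <= N)%N by move=> /asboolP[s [_ _ <-]]; exact: rank_leq_row.
case: (ex_maxnP exP Pub) => r /asboolP[s [us x0s rs]] rmax.
have memW k : k \in s -> (u k <= W s)%MS.
  move=> ks; rewrite /W (big_rem k)//=; apply: submx_trans (addsmxSl _ _).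
  by rewrite genmxE.
have Wk k : k != x0 -> (u k <= W s)%MS.
  move=> kx0; have [/memW//|ks] := boolP (k \in s).
  have Wc : W (k :: s) = (<<u k>> + W s)%MS by rewrite /W big_cons.
  have : (\rank (W (k :: s)) <= \rank (W s))%N.
    rewrite rs; apply: rmax; apply/asboolP; exists (k :: s); split => //=.
      by rewrite ks.
    by rewrite inE negb_or eq_sym kx0.
  have /leqifP : (\rank (W s) <= \rank (W (k :: s)) ?= iff (W (k :: s) <= W s)%MS)%N.
    by apply: mxrank_leqif_sup; rewrite Wc addsmxSr.
  case: ifP => [+ _ _|_ h1 h2]; last by move: (leq_trans h1 h2); rewrite ltnn.
  by rewrite Wc; apply: submx_trans; apply: submx_trans (addsmxSl _ _); rewrite genmxE.
have nWx0 : ~~ (u x0 <= W s)%MS.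
  apply/negP; rewrite /W big_tnth => /sub_sumsmxP[w wE].
  have /choice[e eE] : forall i : 'I_(size s), exists e : F,
      w i *m <<u (tnth (in_tuple s) i)>>%MS = e *: u (tnth (in_tuple s) i).
    move=> i; apply/sub_rVP; apply: submx_trans (submxMl _ _) _; by rewrite genmxE.
  pose c k := if k == x0 then -1 else
     \sum_(i < size s | tnth (in_tuple s) i == k) e i.
  have cx0 : c x0 = -1 by rewrite /c eqxx.
  have := indep (x0 :: s) c; rewrite cons_uniq x0s us mem_head cx0 => /(_ isT).
  suff -> : \sum_(k <- x0 :: s) c k *: u k = 0.
    by move=> /(_ erefl isT)/eqP; rewrite oppr_eq0 oner_eq0.
  rewrite big_cons cx0 scaleN1r wE addrC; apply/eqP; rewrite subr_eq0; apply/eqP.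
  rewrite big_tnth; apply: eq_bigr => i _; rewrite eE; congr (_ *: _).
  rewrite /c ifN; last first.
    by apply: contraNneq x0s => <-; exact: mem_tnth.
  rewrite (bigD1 i)//= big1 ?addr0// => j /andP[/eqP ij ji].
  case/eqP: ji; apply/val_inj/eqP; rewrite -(nth_uniq x0 (ltn_ord j) (ltn_ord i) us).
  by move: ij; rewrite !(tnth_nth x0) /= => ->.
move: nWx0; rewrite submxE => /eqP nz.
have [j ji] : exists j, (u x0 *m cokermx (W s)) ord0 j != 0.
  apply: contrapT => no; apply: nz; apply/matrixP => i j; rewrite ord1 [RHS]mxE.
  by apply/eqP; apply: contrapT => /negP h; apply: no; exists j.
exists (((u x0 *m cokermx (W s)) ord0 j)^-1 *: col j (cokermx (W s))) => k.
set al := _^-1.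
have -> : (u k *m (al *: col j (cokermx (W s)))) ord0 ord0 = al * (u k *m cokermx (W s)) ord0 j.
  by rewrite -scalemxAr [LHS]mxE colE mulmxA -colE [X in _ * X = _]mxE.
rewrite /al.
have [->|/Wk] := eqVneq k x0; first by rewrite mulVf.
by rewrite submxE => /eqP ->; rewrite [X in _ * X]mxE mulr0.
Qed.

(** * Splines built from translates, and solution of the Wexler-Raz equations *)

Section Spline.
Variable R : realType.
Implicit Types (K : R -> Prop) (d : nat -> R) (F G : nat -> R -> R).

Lemma ladder_cst0 K d n : (forall i, d i != 0) -> ladder K d (fun=> cst 0) n.
Proof.
move=> d0; split => //; first by move=> i _ x; exact: cst_continuous.
by move=> i _ x _; rewrite subr0 mul0r; exact: is_derive_cst.
Qed.

Lemma ladder_shift K K' d G n (y : R) : (forall x, K (x - y) -> K' x) ->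
  ladder K d G n -> ladder K' d (fun i x => G i (x - y)) n.
Proof.
move=> KK' lad; split => [i|||i ilen x Kx].
- exact: (ladder_d lad).
- by rewrite (ladder0 lad).
- move=> i ilen x; apply: continuous_comp; last exact: (ladder_cont lad).
  by apply: cvgB => //; exact: cvg_cst.
- have dG := ladder_deriv lad ilen (fun h => Kx (KK' _ h)).
  have := @is_derive1_comp _ (G i.+1) (fun x => x - y) x _ _ dG (is_derive_shift x 1 (- y)).
  by rewrite /GRing.scale/= mulr1.
Qed.

Lemma ladder_axpy K d F G n (c : R) : ladder K d F n -> ladder K d G n ->
  ladder K d (fun i x => c * F i x + G i x) n.
Proof.
move=> lF lG; split => [i|||i ilen x Kx].
- exact: (ladder_d lF).
- by apply/funext => x; rewrite (ladder0 lF) (ladder0 lG) /= mulr0 addr0.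
- move=> i ilen x; apply: cvgD; last exact: (ladder_cont lG).
  by apply: cvgM; [exact: cvg_cst|exact: (ladder_cont lF)].
- have dF := ladder_deriv lF ilen Kx; have dG := ladder_deriv lG ilen Kx.
  have dcF := @is_deriveZ _ _ _ _ c _ _ _ dF.
  have := @is_deriveD _ _ _ _ _ _ _ _ _ dcF dG.
  rewrite /GRing.scale/= => h; apply: is_derive_eq h _.
  have := ladder_d lF i => d0; field; exact: d0.
Qed.

Definition spline (M : nat) G (s : seq int) (c : int -> R) :=
  fun (i : nat) (x : R) => \sum_(k <- s) c k * G i (x - k%:~R * M%:R).

Lemma ladder_spline M d G n s c : ladder (fun x => x = 0) d G n ->
  ladder (knots M) d (spline M G s c) n.
Proof.
move=> lG; elim: s => [|k s IH].
  have -> : spline M G [::] c = fun=> cst 0.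
    by apply/funext => i; apply/funext => x; rewrite /spline big_nil.
  by apply: ladder_cst0 => i; exact: (ladder_d lG).
have -> : spline M G (k :: s) c =
    fun i x => c k * G i (x - k%:~R * M%:R) + spline M G s c i x.
  by apply/funext => i; apply/funext => x; rewrite /spline big_cons.
apply: ladder_axpy IH.
apply: ladder_shift lG => x /eqP; rewrite subr_eq0 => /eqP ->; by exists k.
Qed.

Section Window.
Variables (M a n : nat) (d : nat -> R) (G : nat -> R -> R) (cp cm : R).
Hypotheses (aM : (0 < a < M)%N) (lG : ladder (fun x => x = 0) d G n.+2).
Hypotheses (jump : cp != cm) (G1 : forall t, t != 0 ->
  mulexp (d 0%N) (G 1%N) t = if 0 < t then cp else cm).

(** By [ladder_window] the spline vanishes on [-M, M], so its bottom rung vanishes at the midpoints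
    of both intervals next to the knot 0. Weighted by e^(y / d 0), its values at these two points
    are sums over k that differ only in the term k = 0, by a nonzero multiple of c 0 (cp - cm). *)
Lemma spline_zero (Z : nat) (x : R) s c : (n.+2 * M + Z * a <= Z * M)%N ->
  x <= - M%:R -> M%:R <= x + Z%:R * a%:R -> uniq s ->
  (forall j, (j <= Z)%N -> spline M G s c n.+2 (x + j%:R * a%:R) = 0) ->
  0 \in s -> c 0 = 0.
Proof.
move=> ZP xM MZ us F0 s0.
have M0 : 0 < M%:R :> R by rewrite ltr0n; case/andP: aM => a0; exact: leq_ltn_trans.
have lad := ladder_spline M s c lG.
have {}F0 := ladder_window aM ZP lad F0.
have nK (p : R) : p = - M%:R \/ p = 0 -> forall x, p < x < p + M%:R -> ~ knots M x.
  move=> pE y /andP[py yp] Ky.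
  have Kp : knots M p by case: pE => ->; [exists (-1); rewrite mulN1r|exists 0; rewrite mul0r].
  by have := knot_gap Kp Ky py; lra.
have Z1 (p : R) : p = - M%:R \/ p = 0 -> spline M G s c 1%N (p + M%:R / 2) = 0.
  move=> pE; apply: (ladder_zero_down lad (nK p pE) _ (isT : (1 <= n.+2)%N)).
    by move=> y /andP[y1 y2]; apply: F0; case: pE y1 y2 => -> y1 y2; apply/andP; split; lra.
  by apply/andP; split; lra.
have E (y : R) : (forall k : int, y - k%:~R * M%:R != 0) -> spline M G s c 1%N y = 0 ->
    \sum_(k <- s) c k * expR (k%:~R * M%:R / d 0%N) *
      (if 0 < y - k%:~R * M%:R then cp else cm) = 0.
  move=> yk F1; transitivity (expR (y / d 0%N) * spline M G s c 1%N y); last by rewrite F1 mulr0.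
  rewrite /spline mulr_sumr; apply: eq_bigr => k _; rewrite -G1// /mulexp.
  have -> : expR (y / d 0%N) = expR (k%:~R * M%:R / d 0%N) * expR ((y - k%:~R * M%:R) / d 0%N).
    by rewrite -expRD -mulrDl addrC subrK.
  ring.
have half (k : int) : (0 < M%:R / 2 - k%:~R * M%:R :> R) = (k <= 0).
  have -> : M%:R / 2 - k%:~R * M%:R = M%:R / 2 * (1 - (2 * k)%:~R) :> R.
    by rewrite rmorphM/=; field.
  rewrite pmulr_rgt0 ?divr_gt0// subr_gt0 -[X in _ < X]/(1%:~R) ltr_int.
  by apply/idP/idP; lia.
have halfN (k : int) : (0 < - M%:R + M%:R / 2 - k%:~R * M%:R :> R) = (k < 0).
  have -> : - M%:R + M%:R / 2 - k%:~R * M%:R = M%:R / 2 - (k + 1)%:~R * M%:R :> R.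
    by rewrite rmorphD/=; ring.
  by rewrite half; apply/idP/idP; lia.
have nz (k : int) : (M%:R / 2 - k%:~R * M%:R != 0 :> R).
  have -> : M%:R / 2 - k%:~R * M%:R = M%:R / 2 * (1 - (2 * k)%:~R) :> R.
    by rewrite rmorphM/=; field.
  rewrite mulf_eq0 negb_or gt_eqF ?divr_gt0//= subr_eq0 -[X in X != _]/(1%:~R) eqr_int.
  by apply/eqP; lia.
have nzN (k : int) : (- M%:R + M%:R / 2 - k%:~R * M%:R != 0 :> R).
  have -> : - M%:R + M%:R / 2 - k%:~R * M%:R = M%:R / 2 - (k + 1)%:~R * M%:R :> R.
    by rewrite rmorphD/=; ring.
  exact: nz.
have E1 := E _ nz _; have E2 := E _ nzN (Z1 _ (or_introl erefl)).
have := Z1 _ (or_intror erefl); rewrite add0r => /E1 {}E1.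
move: (congr2 (fun u v => u - v) E1 E2); rewrite subr0 -sumrB.
rewrite (bigD1_seq 0)//= big1 ?addr0; last first.
  move=> k k0; rewrite half halfN; have -> : (k <= 0) = (k < 0) by lia.
  by rewrite subrr.
rewrite half halfN/= -mulrBr => /eqP; rewrite !mulf_eq0 (gt_eqF (expR_gt0 _)) subr_eq0 (negPf jump).
by rewrite !orbF => /eqP.
Qed.

Lemma window_dual (Z : nat) (x : R) : (n.+2 * M + Z * a <= Z * M)%N ->
  x <= - M%:R -> M%:R <= x + Z%:R * a%:R ->
  exists v : nat -> R, forall k : int,
    \sum_(j < Z.+1) G n.+2 (x + j%:R * a%:R - k%:~R * M%:R) * v j = (k == 0)%:R.
Proof.
move=> ZP xM MZ.
have [s c us sc s0|v vP] := @dual_vector R int Z.+1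
  (fun k => \row_(j < Z.+1) G n.+2 (x + j%:R * a%:R - k%:~R * M%:R)) 0.
  apply: (spline_zero ZP xM MZ us _ s0) => j jZ.
  have := congr1 (fun A : 'rV[R]_Z.+1 => A ord0 (Ordinal (jZ : (j < Z.+1)%N))) sc.
  rewrite summxE mxE => <-; apply: eq_bigr => k _; by rewrite !mxE.
exists (fun j => v (inord j) ord0) => k; rewrite -vP mxE; apply: eq_bigr => j _.
by rewrite mxE inord_val.
Qed.

(** For a given n0 the equations involve [gam] only on the residue class of n0 modulo a, so
    [window_dual] solves them separately for each remainder r, the equation for p being the one at
    the knot index -p. [gam] glues these solutions together and is 0 outside the window of
    samples. *)
Lemma dual_sequence : exists (gam : int -> R) (N0 : nat),
  (forall y, N0%:Z < `|y| -> gam y = 0) /\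
  forall (n0 p : int) (K : nat), (`|n0| + N0%:Z <= K%:Z) ->
    \sum_(k <- zrange K) G n.+2 (n0 + p * M%:Z - k * a%:Z)%:~R * gam (n0 - k * a%:Z)
      = (p == 0)%:R.
Proof.
have /andP[a0 ltaM] := aM.
(* J a >= M + r puts the first sample at or left of -M. As M - a >= 1, any Z >= (n + 2) M satisfies
   the zero count; the further 2 M + 1 carries the last sample to M or beyond. *)
have [J JE] : {J | J = M.+1} by exists M.+1.
have [Z ZE] : {Z | Z = (n.+2 * M + 2 * M + 1)%N} by eexists.
have /choice[v vP] : forall r : nat, exists v : nat -> R, (r < a)%N -> forall k : int,
    \sum_(j < Z.+1) G n.+2 (r%:R - J%:R * a%:R + j%:R * a%:R - k%:~R * M%:R) * v j = (k == 0)%:R.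
  move=> r; have [ra|_] := boolP (r < a)%N; last by exists (fun=> 0).
  have [|||v vP] := @window_dual Z (r%:R - J%:R * a%:R).
  - by rewrite ZE; nia.
  - have : (r + M <= J * a)%N by rewrite JE; nia.
    by rewrite -(ler_nat R) natrD natrM; lra.
  - have : (M + J * a <= r + Z * a)%N by rewrite JE ZE; nia.
    by rewrite -(ler_nat R) !natrD !natrM; lra.
  - by exists v.
pose gam (y : int) : R := let q := (y %/ a%:Z)%Z + J%:Z in
  if (0 <= q <= Z%:Z) then v (absz (y %% a%:Z)%Z) (absz q) else 0.
have gam0 y : ((Z + J).+1 * a)%N%:Z < `|y| -> gam y = 0.
  move=> yl; rewrite /gam; case: ifP => // /andP[q0 qZ].
  have := divz_eq y a%:Z; have := modz_ge0 y (_ : a%:Z != 0); have := ltz_mod y (_ : a%:Z != 0).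
  move: (y %/ a%:Z)%Z (y %% a%:Z)%Z q0 qZ => q r; nia.
exists gam, ((Z + J).+1 * a)%N; split=> // n0 p K KP.
pose q := (n0 %/ a%:Z)%Z; pose r := absz (n0 %% a%:Z)%Z.
have aN0 : a%:Z != 0 by lia.
have rE : r%:Z = (n0 %% a%:Z)%Z by rewrite /r gez0_abs ?modz_ge0.
have ra : (r < a)%N by have := ltz_mod n0 aN0; rewrite -rE; lia.
have n0E : n0 = q * a%:Z + r%:Z by rewrite rE -divz_eq.
rewrite -(oppr_eq0 p) -(vP r ra (- p)).
have -> : \sum_(k <- zrange K) G n.+2 (n0 + p * M%:Z - k * a%:Z)%:~R * gam (n0 - k * a%:Z) =
  \sum_(k <- [seq q + J%:Z - j%:Z | j <- iota 0 Z.+1])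
     G n.+2 (n0 + p * M%:Z - k * a%:Z)%:~R * gam (n0 - k * a%:Z).
  apply: eq_big_support; first exact: zrange_uniq.
    by rewrite map_inj_uniq ?iota_uniq// => i j; lia.
  move=> k; rewrite mulf_eq0 negb_or => /andP[_ gk].
  have -> : k \in zrange K.
    rewrite mem_zrange; have [//|kK] := leP `|k| K%:Z.
    by rewrite gam0 ?eqxx in gk => //; nia.
  apply/esym/mapP; move: gk; rewrite /gam n0E addrAC -mulrBl divzMDl// divz_small ?addr0; last
      first.
    by apply/andP; split; lia.
  case: ifP => [/andP[h1 h2] _|_]; last by rewrite eqxx.
  by exists (absz (q - k + J%:Z)); [rewrite mem_iota|]; lia.
rewrite big_map -[X in iota 0 X]subn0 -/(index_iota _ _) big_mkord; apply: eq_bigr => j _.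
have -> : n0 - (q + J%:Z - j%:Z) * a%:Z = (j%:Z - J%:Z) * a%:Z + r%:Z by rewrite n0E; ring.
rewrite /gam divzMDl// modzMDl divz_small ?addr0 ?modz_small; try by apply/andP; split; lia.
rewrite subrK/= lez_nat -ltnS ltn_ord; congr (G _ _ * _).
rewrite n0E !rmorphD/= !rmorphN/= !rmorphM/= !rmorphD/= rmorphN/=; ring.
Qed.
End Window.
End Spline.

(** * Injectivity of the Fourier transform *)

Section Fourier_uniqueness.
Variable R : realType.
Implicit Types (f g D : R -> R).
Local Open Scope classical_set_scope.
Local Notation mu := (@lebesgue_measure R).
Local Notation integ f := (mu.-integrable setT (EFin \o f)).
Local Notation Int f := (Rintegral mu setT f).

Lemma integrable_le f g : continuous f \/ measurable_fun setT f ->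
  (forall x, `|f x| <= `|g x|) -> integ g -> integ f.
Proof.
move=> cf fg; apply: le_integrable => //; last by move=> x _ /=; rewrite lee_fin.
by apply/measurable_EFinP; case: cf => // cf; exact: continuous_measurable_fun.
Qed.

Lemma integrable_bounded_mul f g : integ f -> continuous g -> (forall x, `|g x| <= 1) ->
  integ (fun x => f x * g x).
Proof.
move=> fi cg g1; apply: (integrable_le (g := f)) => //.
  right; apply: measurable_funM; last exact: continuous_measurable_fun.
  by apply/measurable_EFinP; exact: measurable_int fi.
by move=> x; rewrite normrM ler_piMr.
Qed.

Lemma continuous_cos_affine (a b : R) : continuous (fun y => cos (a * y + b)).
Proof.
move=> x; apply: continuous_comp; last exact: continuous_cos.
by apply: cvgD; [apply: cvgM => //; exact: cvg_cst|exact: cvg_cst].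
Qed.

Lemma continuous_exp_fun f n : continuous f -> continuous (fun y => f y ^+ n).
Proof.
move=> cf; elim: n => [|n IH] x; first by rewrite /= (_ : (fun=> _) = cst 1) //; exact: cvg_cst.
rewrite (_ : (fun _ => _) = (fun y => f y * f y ^+ n)); last by apply/funext => y; rewrite exprS.
by apply: cvgM; [exact: cf|exact: IH].
Qed.

Lemma normr_cos_le1 (x : R) : `|cos x| <= 1.
Proof. by rewrite ler_norml cos_geN1 cos_le1. Qed.

(** The product formula trades one power of the cosine for the frequencies om + al and om - al with
    shifted phases, which is why om and b vary in the induction. *)
Lemma trig_pow_zero D (al x0 : R) : continuous D -> integ D ->
  (forall om, Int (fun x => D x * cos (om * x)) = 0) ->
  (forall om, Int (fun x => D x * sin (om * x)) = 0) ->
  forall n om b, Int (fun y => D y * cos (al * y + x0) ^+ n * cos (om * y + b)) = 0.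
Proof.
move=> cD iD Dc Ds.
have iP n : integ (fun y => D y * cos (al * y + x0) ^+ n).
  apply: integrable_bounded_mul => //.
    by apply: continuous_exp_fun; exact: continuous_cos_affine.
  by move=> x; rewrite normrX exprn_ile1// normr_cos_le1.
have iPc n om b : integ (fun y => D y * cos (al * y + x0) ^+ n * cos (om * y + b)).
  apply: integrable_bounded_mul => //; first exact: continuous_cos_affine.
  by move=> x; exact: normr_cos_le1.
elim=> [om b|n IH om b].
  have i1 : integ (fun y => D y * cos (om * y)).
    have := iPc 0%N om 0; congr (integrable _ _ _); apply/funext => y /=.
    by rewrite expr0 mulr1 addr0.
  have i2 : integ (fun y => D y * sin (om * y)).
    have := iPc 0%N om (- (pi / 2)); congr (integrable _ _ _); apply/funext => y /=.
    by rewrite expr0 mulr1 cosBpihalf.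
  transitivity (Int (fun y => D y * cos (om * y) * cos b - D y * sin (om * y) * sin b)).
    apply: eq_Rintegral => y _; rewrite expr0 mulr1 cosD; ring.
  rewrite RintegralB//; last 2 first.
    by apply: (integrable_bounded_mul (g := cst (cos b)) i1) => [|x]; [exact: cst_continuous|exact:
        normr_cos_le1].
    apply: (integrable_bounded_mul (g := cst (sin b)) i2) => [|x]; first exact: cst_continuous.
    by rewrite /= ler_norml sin_geN1 sin_le1.
  by rewrite !RintegralZr// Dc Ds !mul0r subr0.
transitivity (Int (fun y => 2^-1 * (D y * cos (al * y + x0) ^+ n * cos ((om + al) * y + (b + x0)) +
   D y * cos (al * y + x0) ^+ n * cos ((om - al) * y + (b - x0))))).
  apply: eq_Rintegral => y _.
  have -> : (om + al) * y + (b + x0) = (om * y + b) + (al * y + x0) by ring.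
  have -> : (om - al) * y + (b - x0) = (om * y + b) - (al * y + x0) by ring.
  move: (om * y + b) (al * y + x0) => A B; rewrite cosB cosD exprS; by field.
rewrite RintegralZl//; last exact: (integrableD _ (iPc _ _ _) (iPc _ _ _)).
by rewrite RintegralD// !IH addr0 mulr0.
Qed.

(* This makes Gaussians bounded pointwise limits of trigonometric polynomials. *)
Lemma cvg_cos_pow_gauss (u : R) :
  cos (u / n.+1%:R) ^+ (2 * n.+1 ^ 2) @[n --> \oo] --> expR (- u ^+ 2).
Proof.
have hn : (u / n.+1%:R : R) @[n --> \oo] --> 0.
  rewrite -[X in _ --> X](mulr0 u); apply: cvgM; first exact: cvg_cst.
  exact: cvg_harmonic.
have sn : n.+1%:R * sin (u / n.+1%:R) @[n --> \oo] --> u.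
  have [->|u0] := eqVneq u 0.
    rewrite (_ : (fun _ => _) = cst 0); first exact: cvg_cst.
    by apply/funext => n; rewrite mul0r sin0 mulr0.
  have dsin := is_derive_sin (0 : R).
  have : h^-1 *: (sin (h *: (1:R) + 0) - sin 0 : R^o) @[h --> 0^'] --> (cos 0 : R).
    by rewrite -(@derive_val _ _ _ _ _ _ _ dsin); have [] := dsin.
  move=> /cvgr_dnbhsP/(_ (fun n => u / n.+1%:R)) H.
  have {}H : (u / n.+1%:R)^-1 * (sin (u / n.+1%:R)) @[n --> \oo] --> (1 : R).
    rewrite -[X in _ --> X](@cos0 R) (_ : (fun _ => _) = fun n => (u / n.+1%:R)^-1 *: (sin ((u /
        n.+1%:R) *: 1 + 0) - sin 0 : R^o)).
      by apply: H; split => // n; rewrite mulf_neq0// invr_eq0.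
    by apply/funext => n; rewrite [_ *: 1]mulr1 addr0 sin0 subr0.
  rewrite (_ : (fun _ => _) = (fun n => u * ((u / n.+1%:R)^-1 * sin (u / n.+1%:R)))).
    by rewrite -[X in _ --> X]mulr1; apply: cvgM => //; exact: cvg_cst.
  by apply/funext => n; rewrite invfM invrK -mulrA mulVKf.
pose x n := sin (u / n.+1%:R) ^+ 2.
have x0 : x n @[n --> \oo] --> 0.
  rewrite -[X in _ --> X](expr0n _ 2) -[X in X ^+ 2](@sin0 R); apply: cvgM;
    by apply: continuous_cvg => //; exact: continuous_sin.
have Nx : n.+1%:R ^+ 2 * x n @[n --> \oo] --> u ^+ 2.
  rewrite (_ : (fun _ => _) = (fun n => (n.+1%:R * sin (u / n.+1%:R)) * (n.+1%:R * sin (u /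
      n.+1%:R)))).
    by rewrite expr2; apply: cvgM.
  by apply/funext => n; rewrite /x; ring.
have upper : expR (- (n.+1%:R ^+ 2 * x n)) @[n --> \oo] --> expR (- u ^+ 2).
  by apply: continuous_cvg; [exact: continuous_expR|exact: cvgN].
have lower : expR (- (n.+1%:R ^+ 2 * x n / (1 - x n))) @[n --> \oo] --> expR (- u ^+ 2).
  apply: continuous_cvg; [exact: continuous_expR|apply: cvgN].
  rewrite -[X in _ --> X]divr1 -[X in _ / X](subr0 1); apply: cvgM => //.
  by apply: cvgV; [rewrite subr0|apply: cvgB => //; exact: cvg_cst].
(* With N = n + 1 and x = sin(u/N)^2, the bounds e^(-x/(1-x)) <= 1 - x <= e^(-x) raised to the power
   N^2 enclose cos(u/N)^(2 N^2), and N^2 x tends to u^2. *)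
apply: squeeze_cvgr lower upper.
have : \forall n \near \oo, x n < 1 by exact: (cvgr_lt _ x0).
apply: filterS => n xn1.
have xn0 : 0 <= x n by rewrite /x exprn_even_ge0.
have -> : cos (u / n.+1%:R) ^+ (2 * n.+1 ^ 2) = (1 - x n) ^+ (n.+1 ^ 2).
  by rewrite exprM cos2sin2.
have E (v : R) : expR (- (n.+1%:R ^+ 2 * v)) = expR (- v) ^+ (n.+1 ^ 2).
  by rewrite -expRM_natl natrX mulrN.
rewrite -mulrA !E; apply/andP; split.
  apply: lerXn2r; rewrite ?nnegrE ?expR_ge0// ?subr_ge0 ?(ltW xn1)//.
  have x1 : 0 < 1 - x n by rewrite subr_gt0.
  have := expR_ge1Dx (x n / (1 - x n)).
  have -> : 1 + x n / (1 - x n) = (1 - x n)^-1 by field; rewrite gt_eqF.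
  by rewrite expRN => h; rewrite -[leRHS]invrK lef_pV2// posrE ?expR_gt0// invr_gt0.
apply: lerXn2r; rewrite ?nnegrE ?expR_ge0// ?subr_ge0 ?(ltW xn1)//.
by have := expR_ge1Dx (- x n).
Qed.

Definition zero_fourier D := forall om,
  Int (fun x => D x * cos (om * x)) = 0 /\ Int (fun x => D x * sin (om * x)) = 0.

Lemma gauss_zero D (s x0 : R) : continuous D -> integ D -> zero_fourier D ->
  Int (fun y => D y * expR (- (s * (y - x0)) ^+ 2)) = 0.
Proof.
move=> cD iD D0.
pose f n (y : R) := (D y * cos ((s * (y - x0)) / n.+1%:R) ^+ (2 * n.+1 ^ 2))%:E.
have affE n : (fun y => cos ((s * (y - x0)) / n.+1%:R)) =
    (fun y => cos (s / n.+1%:R * y + (- (s / n.+1%:R * x0)))).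
  by apply/funext => y; congr cos; ring.
have f0 n : (\int[mu]_y f n y = 0)%E.
  have := @trig_pow_zero D (s / n.+1%:R) (- (s / n.+1%:R * x0)) cD iD
    (fun om => (D0 om).1) (fun om => (D0 om).2) (2 * n.+1 ^ 2) 0 0.
  have -> : (fun y => D y * cos (s / n.+1%:R * y + (- (s / n.+1%:R * x0))) ^+ (2 * n.+1 ^ 2)
      * cos (0 * y + 0)) = (fun y => D y * cos ((s * (y - x0)) / n.+1%:R) ^+ (2 * n.+1 ^ 2)).
    apply/funext => y; rewrite mul0r addr0 cos0 mulr1; congr (_ * cos _ ^+ _); ring.
  move=> h; suff h2 : (\int[mu]_y f n y)%E \is a fin_num by rewrite -(fineK h2); congr EFin; exact:
      h.
  apply: integrable_fin_num => //.
  apply: (integrable_bounded_mul iD).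
    by apply: continuous_exp_fun; rewrite affE; exact: continuous_cos_affine.
  by move=> x; rewrite normrX exprn_ile1// normr_cos_le1.
have mf n : measurable_fun setT (f n).
  apply/measurable_EFinP; apply: continuous_measurable_fun => x.
  apply: cvgM; first exact: cD.
  by apply: continuous_exp_fun; rewrite affE; exact: continuous_cos_affine.
have cg : continuous (fun y : R => expR (- (s * (y - x0)) ^+ 2)).
  move=> y; apply: continuous_comp; last exact: continuous_expR.
  apply: cvgN; apply: (@continuous_exp_fun (fun y => s * (y - x0)) 2) => {}y.
  by apply: cvgM; [exact: cvg_cst|apply: cvgB => //; exact: cvg_cst].
rewrite /Rintegral -[RHS]/(fine 0%E); congr fine.
have H : (fun n => \int[mu]_x f n x)%E @ \oo -->
   (\int[mu]_x (D x * expR (- (s * (x - x0)) ^+ 2))%:E)%E.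
  have [] // := @dominated_convergence _ _ _ mu setT measurableT f
    (fun y => (D y * expR (- (s * (y - x0)) ^+ 2))%:E) (fun y => `|D y|%:E) mf.
  - by apply/measurable_EFinP; apply: continuous_measurable_fun => y; apply: cvgM; [exact:
      cD|exact: cg].
  - apply: aeW => y _; apply: cvg_EFin; first exact: nearW.
    by apply: cvgM; [exact: cvg_cst|exact: cvg_cos_pow_gauss].
  - exact: integrable_norm.
  - apply: aeW => y n _; rewrite /f /= lee_fin normrM ler_piMr//.
    by rewrite normrX exprn_ile1// normr_cos_le1.
move: H; rewrite (_ : (fun _ => _) = cst 0%E); last by apply/funext => n; exact: f0.
by move=> /cvg_lim <- //; rewrite lim_cst.
Qed.

(** If D x0 > 0, then D >= c > 0 within eta of x0. Against a Gaussian of width 1/s at x0, the part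
    |y - x0| < 1/s contributes at least 2 c / (e s), while the part beyond eta takes away at most N
    e^(-(s eta)^2), where N is the L1 norm of D. For large s the integral would be positive, against
    [gauss_zero]. *)
Lemma zero_fourier_le0 D (x0 : R) : continuous D -> integ D -> zero_fourier D -> D x0 <= 0.
Proof.
move=> cD iD D0; rewrite leNgt; apply/negP => Dx0.
pose c := D x0 / 2; have c0 : 0 < c by rewrite divr_gt0.
have [eta /= eta0 Deta] : exists2 eta, 0 < eta & forall y, `|y - x0| < eta -> c <= D y.
  have : \forall y \near x0, c < D y.
    by apply: (cvgr_gt (D x0) (cD x0)); rewrite /c ltr_pdivrMr// ltr_pMr// ltr1n.
  move=> /nbhs_ballP[e /= e0 He]; exists e => // y yx; apply/ltW/He.
  by rewrite /ball/= distrC.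
pose N := Int (fun y => `|D y|).
have N0 : 0 <= N by apply: Rintegral_ge0.
(* The first summand gives 1/s <= eta; the second makes 2 c / (e s) exceed N / (s eta)^2, which
   bounds the loss. *)
pose s := eta^-1 + N * expR 1 / (c * eta ^+ 2) + 1.
have s0 : 0 < s by rewrite /s ltr_wpDl// addr_ge0 ?invr_ge0 ?(ltW eta0)// divr_ge0 ?mulr_ge0
    ?expR_ge0// ?sqr_ge0// ltW.
have seta : s^-1 <= eta.
  by rewrite -[eta]invrK lef_pV2 ?posrE ?invr_gt0// /s -addrA lerDl addr_ge0// divr_ge0 ?mulr_ge0
      ?expR_ge0 ?sqr_ge0// ltW.
pose A := `]x0 - s^-1, x0 + s^-1[%classic.
have mA : measurable A by exact: measurable_itv.
have muA : mu A = (2 / s)%:E.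
  rewrite lebesgue_measure_itv/= lte_fin ifT; last by rewrite ltrD2l gtrN ?invr_gt0.
  by rewrite -EFinB; congr EFin; ring.
have iA : integ (fun y => c * expR (- 1) * \1_A y).
  have := @integrableZl _ _ _ mu setT measurableT (c * expR (- 1)) (EFin \o \1_A).
  apply; exact: integrable_indic_itv.
have iN : integ (fun y => `|D y| * expR (- (s * eta) ^+ 2)).
  have := @integrableZl _ _ _ mu setT measurableT (expR (- (s * eta) ^+ 2)) _ (integrable_norm iD).
  by congr (integrable _ _ _); apply/funext => y /=; rewrite -EFinM mulrC.
have cg : continuous (fun y : R => expR (- (s * (y - x0)) ^+ 2)).
  move=> y; apply: continuous_comp; last exact: continuous_expR.
  apply: cvgN; apply: (@continuous_exp_fun (fun y => s * (y - x0)) 2) => {}y.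
  by apply: cvgM; [exact: cvg_cst|apply: cvgB => //; exact: cvg_cst].
have : Int (fun y => c * expR (- 1) * \1_A y - `|D y| * expR (- (s * eta) ^+ 2)) <=
       Int (fun y => D y * expR (- (s * (y - x0)) ^+ 2)).
  apply: le_Rintegral => //.
  - exact: (integrableB measurableT iA iN).
  - apply: integrable_bounded_mul => // y.
    by rewrite ger0_norm ?expR_ge0// -expR0 ler_expR oppr_le0 sqr_ge0.
  - move=> y _.
    have [yA|yA] := boolP (y \in A).
      rewrite indicE yA mulr1.
      have : `|y - x0| < s^-1.
        by move: yA; rewrite inE /A/= in_itv/= ltr_distl.
      move=> ys; have Dy := Deta y (lt_le_trans ys seta).
      rewrite lerBlDr; apply: (@le_trans _ _ (D y * expR (- (s * (y - x0)) ^+ 2))); last first.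
        by rewrite lerDl mulr_ge0// expR_ge0.
      apply: ler_pM; rewrite ?expR_ge0 ?(ltW c0)// ler_expR lerN2.
      rewrite -(real_normK (num_real (s * (y - x0)))) normrM (gtr0_norm s0) expr_le1 ?mulr_ge0
          ?(ltW s0)//.
      by rewrite -ler_pdivlMl// mulr1 ltW.
    rewrite indicE (negPf yA) mulr0 sub0r.
    have [yeta|yeta] := ltP `|y - x0| eta.
      apply: (@le_trans _ _ 0); first by rewrite oppr_le0 mulr_ge0// expR_ge0.
      by rewrite mulr_ge0 ?expR_ge0// (le_trans (ltW c0))// Deta.
    apply: (@le_trans _ _ (- `|D y| * expR (- (s * (y - x0)) ^+ 2))).
      rewrite !mulNr lerN2 ler_wpM2l// ler_expR lerN2 -(real_normK (num_real (s * (y - x0))))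
          normrM (gtr0_norm s0).
      by apply: lerXn2r; rewrite ?nnegrE ?mulr_ge0 ?(ltW s0) ?(ltW eta0)// ler_wpM2l// ltW.
    by rewrite ler_wpM2r ?expR_ge0// lerNl -normrN ler_norm.
rewrite gauss_zero// RintegralB// RintegralZl//; last first.
  exact: integrable_indic_itv.
rewrite RintegralZr//; last exact: integrable_norm.
have -> : Int (fun y => \1_A y) = 2 / s.
  by rewrite /Rintegral integral_indic// setIT -[RHS]/(fine (2 / s)%:E); congr fine; exact: muA.
rewrite -/N subr_le0.
apply/negP; rewrite -ltNge.
have se0 : 0 < (s * eta) ^+ 2 by rewrite exprn_gt0// mulr_gt0.
have h1 : expR (- (s * eta) ^+ 2) <= ((s * eta) ^+ 2)^-1.
  rewrite expRN lef_pV2 ?posrE ?expR_gt0//.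
  by have := expR_ge1Dx ((s * eta) ^+ 2); apply: le_trans; rewrite lerDr.
apply: (@le_lt_trans _ _ (N * ((s * eta) ^+ 2)^-1)); first by rewrite ler_wpM2l.
have e0 := expR_gt0 (1 : R).
have -> : c * expR (-1) * (2 / s) = (2 * c * s * eta ^+ 2 / expR 1) * ((s * eta) ^+ 2)^-1.
  by rewrite expRN; field; rewrite !gt_eqF.
rewrite ltr_pM2r ?invr_gt0// ltr_pdivlMr//.
have : N * expR 1 / (c * eta ^+ 2) < s.
  by rewrite /s -addrA addrC -addrA ltrDl addr_gt0// invr_gt0.
rewrite ltr_pdivrMr ?mulr_gt0 ?exprn_gt0// => /lt_le_trans; apply.
have : 0 < s * (c * eta ^+ 2) by rewrite mulr_gt0// mulr_gt0// exprn_gt0.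
lra.
Qed.

Lemma fourier_unique D : continuous D -> integ D -> zero_fourier D -> D = cst 0.
Proof.
move=> cD iD D0; apply/funext => x; apply/le_anti; rewrite zero_fourier_le0//=.
rewrite -oppr_le0; apply: (@zero_fourier_le0 (fun x => - D x)).
- by move=> y; apply: cvgN; exact: cD.
- exact: (integrableN iD).
- move=> om; have [h1 h2] := D0 om.
  have ic : integ (fun x => D x * cos (om * x)).
    apply: integrable_bounded_mul => // [|y]; last exact: normr_cos_le1.
    rewrite (_ : (fun _ => _) = fun y => cos (om * y + 0)); first exact: continuous_cos_affine.
    by apply/funext => y; rewrite addr0.
  have is' : integ (fun x => D x * sin (om * x)).
    apply: integrable_bounded_mul => // y; last by rewrite ler_norml sin_geN1 sin_le1.
    apply: continuous_comp; last exact: continuous_sin.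
    by apply: cvgM => //; exact: cvg_cst.
  have E f : integ f -> Int f = 0 -> Int (fun x => - f x) = 0.
    move=> fi f0; rewrite (_ : (fun x => - f x) = (fun x => -1 * f x)).
      by rewrite RintegralZl// f0 mulr0.
    by apply/funext => x0; rewrite mulN1r.
  split; under eq_Rintegral do rewrite mulNr; exact: E.
Qed.
End Fourier_uniqueness.

(** * Totally positive functions of finite type *)

Section ExpPoly.
Variable R : realType.
Implicit Types (p q f : R -> R).
Local Open Scope classical_set_scope.

Inductive exppoly : (R -> R) -> Prop :=
| exppoly0 : exppoly (cst 0)
| exppoly_add c k l f : 0 < l -> exppoly f ->
    exppoly (fun t => c * (t ^+ k * expR (- (l * t))) + f t).

Lemma exppolyD p q : exppoly p -> exppoly q -> exppoly (fun t => p t + q t).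
Proof.
move=> Ep Eq; elim: Ep => [|c k l f l0 Ef IH].
  by rewrite (_ : (fun _ => _) = q)//; apply/funext => t; rewrite add0r.
rewrite (_ : (fun _ => _) = fun t => c * (t ^+ k * expR (- (l * t))) + (f t + q t)).
  exact: exppoly_add.
by apply/funext => t; rewrite addrA.
Qed.

Lemma exppoly_monom c k l : 0 < l -> exppoly (fun t => c * (t ^+ k * expR (- (l * t)))).
Proof.
move=> l0; have := exppoly_add c k l0 exppoly0; congr exppoly.
by apply/funext => t; rewrite addr0.
Qed.

Lemma is_derive_monom (c l t : R) k :
  is_derive t 1 (fun t => c * (t ^+ k * expR (- (l * t))))
    (c * k%:R * (t ^+ k.-1 * expR (- (l * t))) + (- (c * l)) * (t ^+ k * expR (- (l * t)))).
Proof.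
have dE : is_derive t 1 (fun t => expR (- (l * t))) (- l * expR (- (l * t))).
  rewrite (_ : (fun _ => _) = expR \o ((- l) \*: (@idfun R))); last first.
    by apply/funext => y /=; rewrite -mulNr.
  apply: is_derive_eq; rewrite /= /GRing.scale/= mulr1 -mulNr mulrC.
  by [].
have dX : is_derive t 1 (fun t : R => t ^+ k) (k%:R * t ^+ k.-1).
  have := @is_deriveX _ _ (@idfun R) k t 1 1 (is_derive_id _ _).
  rewrite exprfctE /GRing.scale/= mulr1 => h; apply: is_derive_eq h _.
  by case: k => [|k]; rewrite ?mulr0n ?mul0r//= mulr_natl.
have dM := @is_deriveM _ _ _ _ t 1 _ _ dX dE.
have := @is_deriveZ _ _ _ _ c _ _ _ dM; rewrite /GRing.scale/= => h.
apply: is_derive_eq h _; ring.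
Qed.

Lemma exppoly_derive p : exppoly p ->
  exists2 p', exppoly p' & forall t : R, is_derive t 1 p (p' t).
Proof.
elim=> [|c k l f l0 Ef [f' Ef' df']].
  by exists (cst 0); [exact: exppoly0|move=> t; exact: is_derive_cst].
exists (fun t => c * k%:R * (t ^+ k.-1 * expR (- (l * t))) +
   ((- (c * l)) * (t ^+ k * expR (- (l * t))) + f' t)).
  by apply: exppoly_add => //; exact: exppoly_add.
move=> t; rewrite addrA.
exact: (@is_deriveD _ _ _ _ _ _ _ _ _ (is_derive_monom c l t k) (df' t)).
Qed.

Lemma exppoly_continuous p : exppoly p -> continuous p.
Proof.
move=> /exppoly_derive[p' _ dp] x.
by apply/differentiable_continuous/derivable1_diffP; have [] := dp x.
Qed.

(** Half of each exponent absorbs the power: t^k <= k! (2/l)^k e^(l t / 2) for t >= 0, by one term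
    of the exponential series. *)
Lemma exppoly_bounded p : exppoly p -> exists C l, [/\ 0 <= C, 0 < l &
  forall t, 0 <= t -> `|p t| <= C * expR (- (l * t))].
Proof.
elim=> [|c k l f l0 Ef [C [l' [C0 l'0 fb]]]].
  by exists 0, 1; split => // t _; rewrite normr0 mul0r.
pose B := k`!%:R * (2 / l) ^+ k.
have B0 : 0 <= B by rewrite mulr_ge0// exprn_ge0// divr_ge0// ltW.
pose m := Num.min (l / 2) l'.
exists (`|c| * B + C), m; split.
- by rewrite addr_ge0// mulr_ge0.
- by rewrite lt_min divr_gt0.
- move=> t t0; rewrite mulrDl; apply: le_trans (ler_normD _ _) _; apply: lerD; last first.
    apply: le_trans (fb t t0) _; apply: ler_wpM2l => //.
    by rewrite ler_expR lerN2 ler_wpM2r// /m ge_min lexx orbT.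
  rewrite normrM -mulrA ler_wpM2l//.
  rewrite ger0_norm ?mulr_ge0 ?exprn_ge0 ?expR_ge0//.
  have -> : expR (- (l * t)) = expR (- (l / 2 * t)) * expR (- (l / 2 * t)).
    by rewrite -expRD; congr expR; field.
  rewrite mulrA; apply: ler_pM; rewrite ?expR_ge0 ?mulr_ge0 ?exprn_ge0//; last first.
    by rewrite ler_expR lerN2 ler_wpM2r// /m ge_min lexx.
  rewrite expRN ler_pdivrMr ?expR_gt0//.
  have lt0 : 0 <= l / 2 * t by rewrite mulr_ge0// divr_ge0// ltW.
  have h : (l / 2 * t) ^+ k / k`!%:R <= expR (l / 2 * t).
    case: (k) => [|j]; first by rewrite expr0 fact0 divr1; have := expR_ge1Dx (l / 2 * t); apply:
        le_trans; rewrite lerDl.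
    by apply: le_trans (expR_ge1Dxn j lt0); rewrite lerDr.
  have fact_gt0' : 0 < k`!%:R :> R by rewrite ltr0n fact_gt0.
  rewrite (_ : t ^+ k = B * ((l / 2 * t) ^+ k / k`!%:R)); first by rewrite ler_wpM2l.
  have e : (2 / l) ^+ k * (l / 2) ^+ k = 1.
    by rewrite -exprMn (_ : 2 / l * (l / 2) = 1) ?expr1n//; field; rewrite gt_eqF.
  rewrite /B [(l / 2 * t) ^+ k]exprMn -[LHS]mul1r -[X in X * _ = _]e; move: ((2 / l) ^+ k) ((l / 2)
      ^+ k) (t ^+ k) => x y z.
  by field; rewrite gt_eqF.
Qed.

(** Term by term, for the right-hand side t^k e^(-l t): in the resonant case l d = 1 a multiple of
    t^(k+1) e^(-l t) is a solution; otherwise t^k e^(-l t) / (1 - l d) is one up to a term of degree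
    k - 1, which the induction on k removes. *)
Lemma exppoly_solve p d : exppoly p -> d != 0 ->
  exists2 q, exppoly q & forall t : R, is_derive t 1 q ((p t - q t) / d).
Proof.
move=> Ep d0.
have add p1 p2 q1 q2 : (forall t : R, is_derive t 1 q1 ((p1 t - q1 t) / d)) ->
    (forall t : R, is_derive t 1 q2 ((p2 t - q2 t) / d)) ->
    forall t : R, is_derive t 1 (fun t => q1 t + q2 t) ((p1 t + p2 t - (q1 t + q2 t)) / d).
  move=> h1 h2 t; have := @is_deriveD _ _ _ _ _ _ _ _ _ (h1 t) (h2 t) => h.
  by apply: is_derive_eq h _; field.
elim: Ep => [|c k l f l0 Ef [q Eq dq]].
  exists (cst 0); first exact: exppoly0.
  by move=> t; rewrite subrr mul0r; exact: is_derive_cst.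
suff [r Er dr] : exists2 r, exppoly r &
    forall t : R, is_derive t 1 r ((c * (t ^+ k * expR (- (l * t))) - r t) / d).
  exists (fun t => r t + q t); first exact: exppolyD.
  exact: add.
have [ld|ld] := eqVneq (l * d) 1.
  exists (fun t => c / (k.+1%:R * d) * (t ^+ k.+1 * expR (- (l * t)))).
    exact: exppoly_monom.
  move=> t; apply: is_derive_eq (is_derive_monom _ _ _ _) _.
  have -> : l = d^-1 by rewrite -[l](mulfK d0) ld mul1r.
  rewrite /= exprS; field; rewrite d0 /=; exact: lt0r_neq0.
elim: k c => [|k IH] c.
  exists (fun t => c / (1 - l * d) * (t ^+ 0 * expR (- (l * t)))).
    exact: exppoly_monom.
  move=> t; apply: is_derive_eq (is_derive_monom _ _ _ _) _.
  by rewrite !expr0 /=; field; rewrite d0 /= subr_eq0 eq_sym.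
have [r Er dr] := IH (- (c * k.+1%:R * d / (1 - l * d))).
exists (fun t => c / (1 - l * d) * (t ^+ k.+1 * expR (- (l * t))) + r t).
  exact: exppoly_add.
move=> t; have h := @is_deriveD _ _ _ _ _ _ _ _ _ (is_derive_monom (c / (1 - l * d)) l t k.+1) (dr
    t).
apply: is_derive_eq h _ => /=.
by field; rewrite d0 /= subr_eq0 eq_sym.
Qed.
End ExpPoly.

Section Tower.
Variable R : realType.
Implicit Types (p q f : R -> R).
Local Open Scope classical_set_scope.
Local Notation mu := (@lebesgue_measure R).
Local Notation integ f := (mu.-integrable setT (EFin \o f)).
Local Notation Int f := (Rintegral mu setT f).

Definition relaxes (d : R) p q := forall t : R, is_derive t 1 q ((p t - q t) / d).

Lemma exppoly_solve_at p d (v : R) : exppoly p -> 0 < d ->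
  exists q, [/\ exppoly q, relaxes d p q & q 0 = v].
Proof.
move=> Ep d0; have [q Eq dq] := exppoly_solve Ep (lt0r_neq0 d0).
have dV0 : 0 < d^-1 by rewrite invr_gt0.
exists (fun t => (v - q 0) * (t ^+ 0 * expR (- (d^-1 * t))) + q t); split.
- exact: exppoly_add.
- move=> t; have h := @is_deriveD _ _ _ _ _ _ _ _ _ (is_derive_monom (v - q 0) d^-1 t 0) (dq t).
  apply: is_derive_eq h _; rewrite /= expr0; field; exact: lt0r_neq0.
- by rewrite mulr0 oppr0 expR0 expr0 !mulr1 subrK.
Qed.

(** The left half line, read in -t, has the parameter -d. Exactly one of d and -d is positive, and
    on that side the homogeneous solution decays and may be added freely; this is the freedom used
    to prescribe the jump at 0. *)
Lemma exppoly_pair_solve p q d (j : R) : exppoly p -> exppoly q -> d != 0 ->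
  exists p' q', [/\ exppoly p', exppoly q', relaxes d p p', relaxes (- d) q q' & p' 0 - q' 0 = j].
Proof.
move=> Ep Eq d0; have Nd0 : - d != 0 by rewrite oppr_eq0.
have [dlt|dgt|dE] := ltgtP d 0; last by rewrite dE eqxx in d0.
  have [p' Ep' dp'] := exppoly_solve Ep d0.
  have [|q' [Eq' dq' q'0]] := @exppoly_solve_at q (- d) (p' 0 - j) Eq; first by rewrite oppr_gt0.
  by exists p', q'; split => //; rewrite q'0 opprB addrC subrK.
have [q' Eq' dq'] := exppoly_solve Eq Nd0.
have [p' [Ep' dp' p'0]] := @exppoly_solve_at p d (q' 0 + j) Ep dgt.
by exists p', q'; split => //; rewrite p'0 addrC addKr.
Qed.

(** The first rung solves G + d 0 G' = delta in the sense of distributions, hence its jump 1 / d 0;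
    the later rungs have a function on the right-hand side and are continuous at 0. *)
Lemma exppoly_tower (d : nat -> R) : (forall i, d i != 0) ->
  exists P Q : nat -> R -> R,
  [/\ P 0%N = cst 0 /\ Q 0%N = cst 0, forall i, exppoly (P i) /\ exppoly (Q i),
   forall i, relaxes (d i) (P i) (P i.+1) /\ relaxes (- d i) (Q i) (Q i.+1) &
   forall i, P i.+1 0 - Q i.+1 0 = if i == 0%N then (d 0%N)^-1 else 0].
Proof.
move=> d0.
pose T := (nat * ((R -> R) * (R -> R)))%type.
have /choice[next nextP] : forall x : T, exists y : (R -> R) * (R -> R),
    exppoly x.2.1 -> exppoly x.2.2 ->
    [/\ exppoly y.1, exppoly y.2, relaxes (d x.1) x.2.1 y.1, relaxes (- d x.1) x.2.2 y.2
      & y.1 0 - y.2 0 = if x.1 == 0%N then (d 0%N)^-1 else 0].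
  move=> [i [p q]] /=.
  have [[Ep Eq]|no] := pselect (exppoly p /\ exppoly q); last first.
    by exists (p, q) => Ep Eq; exfalso; exact: no.
  have [p' [q' H]] := exppoly_pair_solve (if i == 0%N then (d 0%N)^-1 else 0) Ep Eq (d0 i).
  by exists (p', q').
pose S := fix S i : (R -> R) * (R -> R) := if i is k.+1 then next (k, S k) else (cst 0, cst 0).
have ES i : exppoly (S i).1 /\ exppoly (S i).2.
  elim: i => [|i [E1 E2]]; first by split; exact: exppoly0.
  by have [] := nextP (i, S i) E1 E2.
exists (fun i => (S i).1), (fun i => (S i).2); split => //.
  by move=> i; have [E1 E2] := ES i; have [] := nextP (i, S i) E1 E2.
by move=> i; have [E1 E2] := ES i; have [] := nextP (i, S i) E1 E2.
Qed.

Definition two_sided p q := fun t : R => if 0 <= t then p t else q (- t).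

Lemma two_sided_pos p q (t : R) : 0 < t -> \near t, two_sided p q t = p t.
Proof.
move=> t0; have : \forall y \near t, 0 < y by exact: lt_nbhsr.
by apply: filterS => y y0; rewrite /two_sided ltW.
Qed.

Lemma two_sided_neg p q (t : R) : t < 0 -> \near t, two_sided p q t = q (- t).
Proof.
move=> t0; have : \forall y \near t, y < 0 by exact: lt_nbhsl.
by apply: filterS => y y0; rewrite /two_sided leNgt y0.
Qed.

Lemma is_derive_comp_opp q (t v : R) : is_derive (- t) 1 q v ->
  is_derive t 1 (fun x => q (- x)) (- v).
Proof.
move=> dq; have := @is_derive1_comp _ q -%R t _ _ dq (@is_deriveNid _ _ t 1).
by rewrite /GRing.scale/= mulrN1.
Qed.

Lemma two_sided_continuous p q : continuous p -> continuous q -> p 0 = q 0 -> continuous (two_sided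
    p q).
Proof.
move=> cp cq pq0 t.
have cqN : continuous (fun x => q (- x)).
  by move=> x; apply: continuous_comp; [exact: opp_continuous|exact: cq].
have [t0|t0|->] := ltgtP t 0.
- rewrite /continuous_at /prop_for/= {2}/two_sided leNgt t0/=.
  apply: (cvg_trans (near_eq_cvg (f := fun x => q (- x)) _) (cqN t)).
  by apply: filterS (two_sided_neg p q t0) => y ->.
- rewrite /continuous_at /prop_for/= {2}/two_sided ltW//.
  apply: (cvg_trans (near_eq_cvg (f := p) _) (cp t)).
  by apply: filterS (two_sided_pos p q t0) => y ->.
- apply/cvgrPdist_lt => e e0.
  have E0 : two_sided p q 0 = p 0 by rewrite /two_sided lexx.
  have h1 : \forall x \near 0, `|p 0 - p x| < e by move/cvgrPdist_lt: (cp 0); apply.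
  have h2 : \forall x \near 0, `|q (- 0) - q (- x)| < e by move/cvgrPdist_lt: (cqN 0); apply.
  apply: filterS2 h1 h2 => x h1 h2; rewrite E0 /two_sided; case: ifP => // _.
  by rewrite pq0; move: h2; rewrite oppr0.
Qed.

Lemma two_sided_relaxes d p q p' q' : d != 0 -> relaxes d p p' -> relaxes (- d) q q' ->
  forall t : R, t <> 0 -> is_derive t 1 (two_sided p' q') ((two_sided p q t - two_sided p' q' t) /
      d).
Proof.
move=> d0 dp dq t /eqP; rewrite neq_lt => /orP[t0|t0].
- have h := is_derive_comp_opp (dq (- t)).
  have -> : (two_sided p q t - two_sided p' q' t) / d = - ((q (- t) - q' (- t)) / - d).
    by rewrite /two_sided leNgt t0/= invrN mulrN opprK.
  apply: near_eq_is_derive h.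
  by apply: filterS (two_sided_neg p' q' t0) => y ->.
- have -> : (two_sided p q t - two_sided p' q' t) / d = (p t - p' t) / d by rewrite /two_sided ltW.
  apply: near_eq_is_derive (dp t).
  by apply: filterS (two_sided_pos p' q' t0) => y ->.
Qed.

Lemma two_sided_bounded p q : exppoly p -> exppoly q -> exists C l, [/\ 0 <= C, 0 < l &
  forall t, `|two_sided p q t| <= C * expR (- (l * `|t|))].
Proof.
move=> /exppoly_bounded[C1 [l1 [C10 l10 b1]]] /exppoly_bounded[C2 [l2 [C20 l20 b2]]].
exists (C1 + C2), (Num.min l1 l2); split; [exact: addr_ge0|by rewrite lt_min l10|].
move=> t; rewrite /two_sided; case: (leP 0 t) => t0.
- apply: le_trans (b1 t t0) _; rewrite ger0_norm//.
  apply: ler_pM; rewrite ?expR_ge0//; first by rewrite lerDl.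
  by rewrite ler_expR lerN2 ler_wpM2r// ge_min lexx.
- have t0' : 0 <= - t by rewrite oppr_ge0 ltW.
  apply: le_trans (b2 _ t0') _; rewrite ltr0_norm//.
  apply: ler_pM; rewrite ?expR_ge0//; first by rewrite lerDr.
  by rewrite ler_expR lerN2 ler_wpM2r// ge_min lexx orbT.
Qed.

Lemma integrable_exp_abs (l : R) : 0 < l -> integ (fun t => expR (- (l * `|t|))).
Proof.
move=> l0.
have cf : continuous (fun t : R => expR (- (l * `|t|))).
  move=> t; apply: continuous_comp; last exact: continuous_expR.
  apply: cvgN; apply: cvgM; first exact: cvg_cst.
  exact: norm_continuous.
apply/integrableP; split; first by apply/measurable_EFinP; exact: continuous_measurable_fun.
under eq_integral do rewrite /= ger0_norm ?expR_ge0//.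
rewrite ge0_symfun_integralT//; last by move=> x /=; rewrite normrN.
have h : (\int[mu]_(x in [set x | (0 <= x)%R]) (expR (- (l * `|x|)))%:E <= (l^-1)%:E)%E.
  have -> : ((l^-1)%:E = \int[mu]_x ((l^-1)%:E * (exponential_pdf l x)%:E))%E.
    rewrite integralZl//; last exact: integrable_exponential_pdf.
    by rewrite integral_exponential_pdf// mule1.
  rewrite integral_mkcond; apply: ge0_le_integral => //.
  - by move=> x _; rewrite patchE; case: ifP => // _; rewrite lee_fin expR_ge0.
  - apply/measurable_restrict => //; first by rewrite -set_itvcy.
    by apply: measurable_funTS; apply/measurable_EFinP; exact: continuous_measurable_fun.
  - by apply: measurable_funeM; apply/measurable_EFinP; exact: measurable_exponential_pdf.
  - move=> x _; rewrite patchE; case: ifPn.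
      rewrite inE /= => x0; rewrite exponential_pdfE//= ger0_norm// lee_fin mulNr mulrA mulVf
          ?mul1r//.
      exact: lt0r_neq0.
    by move=> _; rewrite mule_ge0// lee_fin ?invr_ge0 ?exponential_pdf_ge0// ltW.
apply: (@le_lt_trans _ _ (2%:E * (l^-1)%:E)%E); last by rewrite ltry.
by rewrite lee_pmul2l// ltry.
Qed.
End Tower.

(** * Fourier transforms along the tower *)

Section FourierTower.
Variable R : realType.
Implicit Types (p q f : R -> R).
Local Open Scope classical_set_scope.
Local Notation mu := (@lebesgue_measure R).
Local Notation integ f := (mu.-integrable setT (EFin \o f)).
Local Notation Int f := (Rintegral mu setT f).

Lemma measurable_two_sided p q : exppoly p -> exppoly q -> measurable_fun setT (two_sided p q).
Proof.
move=> Ep Eq; apply: measurable_fun_ifT.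
- exact: measurable_fun_ler.
- by apply: continuous_measurable_fun; exact: exppoly_continuous.
- apply: continuous_measurable_fun => t; apply: continuous_comp; first exact: opp_continuous.
  exact: exppoly_continuous.
Qed.

Lemma integrable_two_sided p q : exppoly p -> exppoly q -> integ (two_sided p q).
Proof.
move=> Ep Eq; have [C [l [C0 l0 bd]]] := two_sided_bounded Ep Eq.
apply: (@integrable_le R _ (fun t => C * expR (- (l * `|t|)))).
- by right; exact: measurable_two_sided.
- by move=> t; rewrite [leRHS]ger0_norm ?mulr_ge0 ?expR_ge0.
- exact: (integrableZl _ _ (integrable_exp_abs l0)).
Qed.

Lemma cvg_Rintegral_itv f : integ f ->
  (fun n : nat => Rintegral mu `[- n%:R, n%:R] f) @ \oo --> Int f.
Proof.
move=> fi.
have mf : measurable_fun setT f by apply/measurable_EFinP; exact: measurable_int fi.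
pose fn (n : nat) := (EFin \o f) \_ `[- n%:R, n%:R]%classic.
have mfn n : measurable_fun setT (fn n).
  by apply/measurable_restrict => //; apply: measurable_funTS; exact: measurable_int fi.
have [|||_ _ H] := @dominated_convergence _ _ _ mu setT measurableT fn (EFin \o f)
    (fun y => `|f y|%:E) mfn (measurable_int _ fi).
- apply: aeW => y _; apply: cvg_near_cst.
  exists (Num.bound `|y|) => // n /= yn; rewrite /fn patchE ifT// inE/= in_itv/=.
  rewrite -ler_norml; apply: (le_trans (ltW (archi_boundP (normr_ge0 y)))).
  by rewrite ler_nat.
- exact: integrable_norm.
- apply: aeW => y n _; rewrite /fn patchE; case: ifP => _; first by rewrite lee_fin.
  by rewrite abse0 lee_fin.
have fin : (\int[mu]_x (f x)%:E)%E \is a fin_num by exact: integrable_fin_num.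
have -> : Int f = fine (\int[mu]_x (f x)%:E)%E by [].
rewrite (_ : (fun _ => _) = fun n => fine (\int[mu]_x fn n x)%E); last first.
  by apply/funext => n; rewrite /Rintegral integral_mkcond.
by apply: fine_cvg; rewrite fineK.
Qed.

Lemma Rintegral_FTC (F f : R -> R) (a b : R) : a <= b -> continuous f ->
  (forall x : R, is_derive x 1 F (f x)) -> Rintegral mu `[a, b] f = F b - F a.
Proof.
move=> ab cf dF.
move: ab; rewrite le_eqVlt => /predU1P[->|ab]; first by rewrite set_itv1 Rintegral_set1 subrr.
have cF : continuous F.
  by move=> x; apply/differentiable_continuous/derivable1_diffP; have [] := dF x.
rewrite /Rintegral (continuous_FTC2 (F := F) ab)//.
- exact: continuous_subspaceT.
- split; [by move=> x _; have [] := dF x|apply: cvg_at_right_filter|apply: cvg_at_left_filter];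
    exact: cF.
- by move=> x _; rewrite derive1E; exact: derive_val.
Qed.

Lemma is_derive_mul_cos f (om b t v : R) : is_derive t 1 f v ->
  is_derive t 1 (fun t => f t * cos (om * t + b))
    (v * cos (om * t + b) - om * (f t * sin (om * t + b))).
Proof.
move=> df.
have da : is_derive t 1 (fun t => om * t + b) om.
  have := @is_deriveD _ _ _ _ _ t 1 _ _ (@is_deriveZ _ _ _ (@idfun R) om t 1 1 (is_derive_id _ _))
      (is_derive_cst b t 1).
  by move=> h; apply: is_derive_eq h _; rewrite /GRing.scale/= mulr1 addr0.
have dc := @is_derive1_comp _ (@cos R) (fun t => om * t + b) t _ _ (is_derive_cos _) da.
have := @is_deriveM _ _ _ _ t 1 _ _ df dc; rewrite /GRing.scale/= => h.
by apply: is_derive_eq h _; ring.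
Qed.

Section Step.
Variables (d j : R) (p q p' q' : R -> R).
Hypotheses (d0 : d != 0) (Ep : exppoly p) (Eq : exppoly q) (Ep' : exppoly p') (Eq' : exppoly q').
Hypotheses (dp : relaxes d p p') (dq : relaxes (- d) q q') (jump : p' 0 - q' 0 = j).

Let continuous_sin_affine (a b : R) : continuous (fun y => sin (a * y + b)).
Proof.
move=> x; apply: continuous_comp; last exact: continuous_sin.
by apply: cvgD; [apply: cvgM => //; exact: cvg_cst|exact: cvg_cst].
Qed.

Let integrable_cos f om b : integ f -> integ (fun x => f x * cos (om * x + b)).
Proof.
move=> fi; apply: integrable_bounded_mul => //; first exact: continuous_cos_affine.
by move=> x; exact: normr_cos_le1.
Qed.

Let integrable_sin f om b : integ f -> integ (fun x => f x * sin (om * x + b)).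
Proof.
move=> fi; apply: integrable_bounded_mul => //.
by move=> x; rewrite ler_norml sin_geN1 sin_le1.
Qed.

(** Integration by parts on both half lines: the boundary terms at infinity decay and those at 0
    combine to the jump j. The pair p', q' is the next rung, not a pair of derivatives; the phase b
    covers cosine and sine transforms at once. *)
Lemma Rintegral_two_sided_step om b :
  Int (fun x => two_sided p q x * cos (om * x + b)) =
  Int (fun x => two_sided p' q' x * cos (om * x + b)) +
  d * (om * Int (fun x => two_sided p' q' x * sin (om * x + b)) - j * cos b).
Proof.
(* Off 0 this is the derivative of [two_sided p' q' t * cos (om * t + b)]. *)
pose h t := (two_sided p q t - two_sided p' q' t) / d * cos (om * t + b) - om * (two_sided p' q' t
    * sin (om * t + b)).
have iG := integrable_two_sided Ep Eq; have iG' := integrable_two_sided Ep' Eq'.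
have i1 : integ (fun t => d^-1 * (two_sided p q t * cos (om * t + b))).
  exact: (integrableZl _ _ (integrable_cos om b iG)).
have i2 : integ (fun t => d^-1 * (two_sided p' q' t * cos (om * t + b))).
  exact: (integrableZl _ _ (integrable_cos om b iG')).
have i3 : integ (fun t => om * (two_sided p' q' t * sin (om * t + b))).
  exact: (integrableZl _ _ (integrable_sin om b iG')).
have hE : h = fun t => d^-1 * (two_sided p q t * cos (om * t + b)) - d^-1 * (two_sided p' q' t *
    cos (om * t + b)) - om * (two_sided p' q' t * sin (om * t + b)).
  by apply/funext => t; rewrite /h; ring.
have ih : integ h by rewrite hE; exact: (integrableB measurableT (integrableB measurableT i1 i2)
    i3).
suff H : Int h = - (j * cos b).
  move: H; rewrite hE RintegralB// ?RintegralB//; last exact: (integrableB measurableT i1 i2).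
  rewrite !RintegralZl//; try exact: integrable_cos; try exact: integrable_sin.
  move=> E; rewrite -[j * cos b]opprK -E opprK; field; exact: d0.
have cEp := exppoly_continuous Ep; have cEp' := exppoly_continuous Ep'.
have cN f : exppoly f -> continuous (fun x => f (- x)).
  move=> Ef x; apply: continuous_comp; first exact: opp_continuous.
  exact: exppoly_continuous.
have cform f g : continuous f -> continuous g -> continuous
    (fun t => (f t - g t) / d * cos (om * t + b) - om * (g t * sin (om * t + b))).
  move=> cf cg x; apply: cvgB.
    apply: cvgM; last exact: continuous_cos_affine.
    by apply: cvgM; [apply: cvgB; [exact: cf|exact: cg]|exact: cvg_cst].
  apply: cvgM; first exact: cvg_cst.
  by apply: cvgM; [exact: cg|exact: continuous_sin_affine].
have right (n : nat) : Rintegral mu `[0, n%:R] h = p' n%:R * cos (om * n%:R + b) - p' 0 * cos b.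
  transitivity (Rintegral mu `[0, n%:R]
    (fun t => (p t - p' t) / d * cos (om * t + b) - om * (p' t * sin (om * t + b)))).
    by apply: eq_Rintegral => t; rewrite inE/= in_itv/= => /andP[t0 _]; rewrite /h /two_sided t0.
  have /= -> := @Rintegral_FTC (fun t => p' t * cos (om * t + b)) _ 0 n%:R (ler0n _ _)
    (cform _ _ cEp cEp') (fun t => is_derive_mul_cos om b (dp t)).
  by rewrite mulr0 add0r.
have left (n : nat) : Rintegral mu `[- n%:R, 0] h = q' 0 * cos b - q' n%:R * cos (om * - n%:R + b).
  pose k t := (q (- t) - q' (- t)) / d * cos (om * t + b) - om * (q' (- t) * sin (om * t + b)).
  have ck : continuous k by apply: (cform (fun t => q (- t)) (fun t => q' (- t))); exact: cN.
  (* At 0 [two_sided] takes its right branch, so the endpoint is removed before [h] is replaced by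
     the left formula, and restored afterwards. *)
  transitivity (Rintegral mu `[- n%:R, 0[ h).
    by rewrite Rintegral_itv_bndo_bndc//; apply: integrableS ih.
  transitivity (Rintegral mu `[- n%:R, 0[ k).
    by apply: eq_Rintegral => t; rewrite inE/= in_itv/= => /andP[_ t0]; rewrite /h /k /two_sided
        leNgt t0.
  rewrite Rintegral_itv_bndo_bndc; last first.
    have : mu.-integrable `[- n%:R, 0] (EFin \o k).
      apply: continuous_compact_integrable; first exact: segment_compact.
      exact: continuous_subspaceT.
    by apply: integrableS => //; apply: subset_itvl; rewrite bnd_simp.
  have dk (t : R) : is_derive t 1 (fun t => q' (- t) * cos (om * t + b)) (k t).
    apply: (is_derive_mul_cos (f := fun t => q' (- t))).
    have := is_derive_comp_opp (dq (- t)).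
    by rewrite invrN mulrN opprK.
  have /= -> := @Rintegral_FTC (fun t => q' (- t) * cos (om * t + b)) k (- n%:R) 0 _ ck dk.
    by rewrite oppr0 opprK mulr0 add0r.
  by rewrite oppr_le0.
have E (n : nat) : Rintegral mu `[- n%:R, n%:R] h =
   p' n%:R * cos (om * n%:R + b) - q' n%:R * cos (om * - n%:R + b) - j * cos b.
  have := @Rintegral_itvB _ h (BLeft (- n%:R)) (BRight n%:R) 0.
  rewrite !bnd_simp oppr_le0 ler0n => H.
  have {}H := fun i => H i isT isT.
  rewrite -(subrK (Rintegral mu `[- n%:R, 0] h) (Rintegral mu `[- n%:R, n%:R] h)) H; last by apply:
      integrableS ih.
  rewrite Rintegral_itv_obnd_cbnd; last by apply: integrableS ih.
  by rewrite left right -jump; ring.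
have tail f s : exppoly f -> (fun n : nat => f n%:R * cos (om * (s * n%:R) + b)) @ \oo --> 0.
  move=> Ef; have [C [l [C0 l0 bf]]] := exppoly_bounded Ef.
  have eC : (fun n : nat => C * expR (- (l * n%:R))) @ \oo --> 0.
    rewrite -[X in _ --> X](mulr0 C); apply: cvgM; first exact: cvg_cst.
    apply: (@cvg_comp _ _ _ (fun n : nat => n%:R) (fun x => expR (- (l * x))) _ (pinfty_nbhs R)).
      exact: cvgr_idn.
    apply: (@cvg_comp _ _ _ (fun x => l * x) (fun x => expR (- x)) _ (pinfty_nbhs R)).
      by apply: gt0_cvgMry => //; exact: cvg_id.
    exact: cvgr_expR.
  apply: (@squeeze_cvgr _ _ _ _ (fun n : nat => - (C * expR (- (l * n%:R)))) (fun n : nat => C *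
      expR (- (l * n%:R)))) => //.
    apply: nearW => n; rewrite -ler_norml normrM.
    by apply: le_trans (bf _ (ler0n _ n)); rewrite ler_piMr// normr_cos_le1.
  by rewrite -oppr0; exact: cvgN.
have := cvg_Rintegral_itv ih; rewrite (_ : (fun _ => _) = fun n : nat =>
   p' n%:R * cos (om * (1 * n%:R) + b) - q' n%:R * cos (om * (-1 * n%:R) + b) - j * cos b).
  move=> h1; have h2 : (fun n : nat => p' n%:R * cos (om * (1 * n%:R) + b) - q' n%:R * cos (om *
      (-1 * n%:R) + b) - j * cos b) @ \oo --> 0 - 0 - j * cos b.
    by apply: cvgB; [apply: cvgB; exact: tail|exact: cvg_cst].
  have -> : Int h = 0 - 0 - j * cos b by exact: cvg_unique h1 h2.
  by rewrite subr0 sub0r.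
by apply/funext => n; rewrite E mul1r mulN1r.
Qed.
End Step.
End FourierTower.

(** * Identification of [g] with the top of a tower *)

Section Structure.
Variable R : realType.
Local Open Scope classical_set_scope.
Local Notation mu := (@lebesgue_measure R).
Local Notation integ f := (mu.-integrable setT (EFin \o f)).
Local Notation Int f := (Rintegral mu setT f).

Lemma continuous_cos_mul (om : R) : continuous (fun y => cos (om * y)).
Proof.
move=> x; apply: continuous_comp; last exact: continuous_cos.
by apply: cvgM => //; exact: cvg_cst.
Qed.

Definition tower (d : nat -> R) (P Q : nat -> R -> R) :=
  [/\ P 0%N = cst 0 /\ Q 0%N = cst 0, forall i, exppoly (P i) /\ exppoly (Q i),
   forall i, relaxes (d i) (P i) (P i.+1) /\ relaxes (- d i) (Q i) (Q i.+1) &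
   forall i, P i.+1 0 - Q i.+1 0 = if i == 0%N then (d 0%N)^-1 else 0].

Section Tower.
Variables (d : nat -> R) (P Q : nat -> R -> R).
Hypotheses (d0 : forall i, d i != 0) (tow : tower d P Q).
Let G i := two_sided (P i) (Q i).

Lemma two_sided0 : G 0%N = cst 0.
Proof. by have [[P0 Q0] _ _ _] := tow; apply/funext => t; rewrite /G /two_sided P0 Q0; case: ifP.
    Qed.

Lemma tower_ladder n : ladder (fun x => x = 0) d G n.
Proof.
have [_ E dr jp] := tow; split => //; first exact: two_sided0.
- move=> i _; have [E1 E2] := E i.+2; apply: two_sided_continuous; try exact: exppoly_continuous.
  by apply/eqP; rewrite -subr_eq0; apply/eqP; exact: jp.
- by move=> i _ x x0; have [r1 r2] := dr i; exact: two_sided_relaxes.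
Qed.

Lemma tower_jump t : t != 0 ->
  mulexp (d 0%N) (G 1%N) t = if 0 < t then P 1%N 0 else Q 1%N 0.
Proof.
have [[P0 Q0] _ dr _] := tow; have [dP dQ] := dr 0%N.
have cst_mulexp (c : R) (f : R -> R) : c != 0 -> relaxes c (cst 0) f -> forall x, mulexp c f x = f
    0.
  move=> c0 df x; transitivity (mulexp c f 0); last by rewrite /mulexp mul0r expR0 mul1r.
  apply: is_derive_0_is_cst => y; have := is_derive_mulexp c0 (df y).
  by rewrite mulr0 mul0r.
rewrite neq_lt => /orP[t0|t0].
- rewrite ltNge (ltW t0)/= -(cst_mulexp (- d 0%N) (Q 1%N) _ _ (- t)) ?oppr_eq0//.
    by rewrite /mulexp /G /two_sided leNgt t0/= invrN mulrNN.
  by rewrite -Q0.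
- rewrite t0 -(cst_mulexp (d 0%N) (P 1%N) _ _ t)//; last by rewrite -P0.
  by rewrite /mulexp /G /two_sided ltW.
Qed.

Lemma tower_integrable i : integ (G i).
Proof. by have [_ E _ _] := tow; have [E1 E2] := E i; exact: integrable_two_sided. Qed.

Definition Fcos (f : R -> R) om := Int (fun x => f x * cos (om * x)).
Definition Fsin (f : R -> R) om := Int (fun x => f x * sin (om * x)).

(** The summand 1 at i = 0 is the transform of the point mass from which the tower starts. *)
Lemma Fcos_step i om : Fcos (G i) om + (i == 0%N)%:R =
  Fcos (G i.+1) om + d i * om * Fsin (G i.+1) om.
Proof.
have [_ E dr jp] := tow; have [E1 E2] := E i; have [E3 E4] := E i.+1; have [r1 r2] := dr i.
have := Rintegral_two_sided_step (d0 i) E1 E2 E3 E4 r1 r2 (jp i) om 0.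
under eq_Rintegral do rewrite addr0.
under [X in _ = X + _ -> _]eq_Rintegral do rewrite addr0.
under [X in _ = _ + _ * (_ * X - _) -> _]eq_Rintegral do rewrite addr0.
rewrite -/(Fcos _ _) -/(Fcos _ _) -/(Fsin _ _) cos0 mulr1 => ->.
case: i {E E1 E2 E3 E4 r1 r2 jp} => [|i] /=; last by ring.
by field; exact: d0.
Qed.

Lemma Fsin_step i om : Fsin (G i) om = Fsin (G i.+1) om - d i * om * Fcos (G i.+1) om.
Proof.
have [_ E dr jp] := tow; have [E1 E2] := E i; have [E3 E4] := E i.+1; have [r1 r2] := dr i.
have := Rintegral_two_sided_step (d0 i) E1 E2 E3 E4 r1 r2 (jp i) om (- (pi / 2)).
under eq_Rintegral do rewrite cosBpihalf.
under [X in _ = X + _ -> _]eq_Rintegral do rewrite cosBpihalf.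
under [X in _ = _ + _ * (_ * X - _) -> _]eq_Rintegral do rewrite sinBpihalf mulrN -mulN1r.
rewrite RintegralZl//; last first.
  apply: integrable_bounded_mul; [exact: tower_integrable| |by move=> x; exact: normr_cos_le1].
  exact: continuous_cos_mul.
rewrite -/(Fsin _ _) -/(Fsin _ _) -/(Fcos _ _) cosN cos_pihalf mulr0 subr0 => ->.
by ring.
Qed.

Lemma tower_fourier n om : ((Fcos (G n.+1) om) +i* (- Fsin (G n.+1) om) : R[i]) =
  \prod_(k < n.+1) (1 + (d k * om)%:C * 'i)^-1.
Proof.
have nz k : 1 + (d k * om)%:C * 'i != 0 :> R[i].
  by apply/eqP => /(congr1 (@complex.Re R)) /=; rewrite !mul0r !mulr0 subrr addr0 => /eqP; rewrite
      oner_eq0.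
elim: n => [|n IH].
  rewrite big_ord_recl big_ord0 mulr1; apply: (mulIf (nz 0%N)); rewrite mulVf//.
  have := Fcos_step 0 om; have := Fsin_step 0 om; rewrite two_sided0 /Fcos /Fsin.
  under eq_Rintegral do rewrite mul0r.
  under [X in _ -> X + _ = _ -> _]eq_Rintegral do rewrite mul0r.
  rewrite Rintegral_cst// mul0r add0r/= => h1 h2.
  apply/eqP; rewrite eq_complex/=; apply/andP; split; apply/eqP.
    by apply: etrans (esym h2); ring.
  by apply: oppr_inj; rewrite oppr0; apply: etrans (esym h1); ring.
rewrite big_ord_recr/= -IH; apply: (mulIf (nz n.+1)); rewrite mulfVK//.
have hc := Fcos_step n.+1 om; rewrite addr0 in hc.
rewrite (Fsin_step n.+1) hc.
apply/eqP; rewrite eq_complex/=; apply/andP; split; apply/eqP; ring.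
Qed.
End Tower.

Lemma tp_structure (g : R -> R) (m : nat) : (2 <= m)%N ->
  totally_positive_finite_type g m -> continuous g ->
  exists (d : nat -> R) (P Q : nat -> R -> R) (c : R),
   [/\ 0 < c, forall i, d i != 0, tower d P Q & forall x, g x = c * two_sided (P m) (Q m) x].
Proof.
move=> m2 [ig [c [delta [c0 [delta0 gF]]]]] cg.
(* Towers are infinite, so [delta] is continued beyond m by a nonzero value. *)
pose d (i : nat) : R := if insub i is Some k then delta k else 1.
have d0 i : d i != 0 by rewrite /d; case: insubP => [k _ _|_]; rewrite ?oner_eq0.
have [P [Q tow]] := exppoly_tower d0.
exists d, P, Q, c; split => // x.
pose G := two_sided (P m) (Q m).
have iG : integ G by exact: tower_integrable tow m.
have cG : continuous G.
  by have := ladder_cont (tower_ladder d0 tow m) (i := m.-2); rewrite (_ : m.-2.+2 = m) ?leqnn;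
      [apply|lia].
have iD : integ (fun x => g x - c * G x).
  exact: (integrableB measurableT ig (integrableZl _ c iG)).
suff /(congr1 (fun f => f x)) /= : (fun x => g x - c * G x) = cst 0.
  by move=> /eqP; rewrite subr_eq0 => /eqP.
apply: fourier_unique => //.
  by move=> y; apply: cvgB; [exact: cg|apply: cvgM; [exact: cvg_cst|exact: cG]].
move=> om.
have icos f : integ f -> integ (fun x => f x * cos (om * x)).
  move=> fi; apply: integrable_bounded_mul => //; last by move=> y; exact: normr_cos_le1.
  exact: continuous_cos_mul.
have isin f : integ f -> integ (fun x => f x * sin (om * x)).
  move=> fi; apply: integrable_bounded_mul => // y; last by rewrite ler_norml sin_geN1 sin_le1.
  apply: continuous_comp; last exact: continuous_sin.
  by apply: cvgM => //; exact: cvg_cst.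
have E : Fcos g om = c * Fcos G om /\ Fsin g om = c * Fsin G om.
  have := gF (om / (2 * pi)); rewrite /fourier.
  have pi0 : (2 * pi : R) != 0 by rewrite mulf_eq0 pnatr_eq0/= gt_eqF// pi_gt0.
  have xE y : 2 * pi * y * (om / (2 * pi)) = om * y by rewrite mulrC mulrA mulfVK.
  under eq_Rintegral do rewrite xE.
  under [X in _ +i* (- X) = _ -> _]eq_Rintegral do rewrite xE.
  rewrite -/(Fcos _ _) -/(Fsin _ _).
  have -> : \prod_(k < m) (1 + (2 * pi * delta k * (om / (2 * pi)))%:C * 'i)^-1 =
     \prod_(k < m) (1 + (d k * om)%:C * 'i)^-1.
    by apply: eq_bigr => k _; rewrite xE [om * _]mulrC /d valK.
  have [n mE] : {n | m = n.+1} by exists m.-1; lia.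
  rewrite mE -(tower_fourier d0 tow) -mE.
  move=> /eqP; rewrite eq_complex/= => /andP[/eqP -> /eqP].
  rewrite !mul0r subr0 addr0 mulrN => /oppr_inj ->; by [].
split.
  under eq_Rintegral do rewrite mulrBl -mulrA.
  rewrite RintegralB//; [|exact: icos|exact: (integrableZl _ c (icos _ iG))].
  by rewrite RintegralZl//; [rewrite -/(Fcos _ _) -/(Fcos _ _) E.1 subrr|exact: icos].
under eq_Rintegral do rewrite mulrBl -mulrA.
rewrite RintegralB//; [|exact: isin|exact: (integrableZl _ c (isin _ iG))].
by rewrite RintegralZl//; [rewrite -/(Fsin _ _) -/(Fsin _ _) E.2 subrr|exact: isin].
Qed.
End Structure.

(** * Frames of sequences *)

Section Modulus.
Variable R : realType.
Implicit Types (z w : R[i]).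

Local Notation cabs := (@Normc.normc R).

Lemma cabs_ge0 z : 0 <= cabs z.
Proof. by case: z => a b; exact: sqrtr_ge0. Qed.

Lemma sqnE z : sqn z = cabs z ^+ 2.
Proof. by case: z => a b; rewrite /sqn /= sqr_sqrtr// addr_ge0// sqr_ge0. Qed.

Lemma sqn_ge0 z : 0 <= sqn z.
Proof. by rewrite addr_ge0// sqr_ge0. Qed.

Lemma cabsJ z : cabs z^* = cabs z.
Proof. by case: z => a b /=; rewrite sqrrN. Qed.

Lemma cabs_expj (x : R) : cabs (expj x) = 1.
Proof. by rewrite /expj /= cos2Dsin2 sqrtr1. Qed.

Lemma cabs_real (x : R) : cabs x%:C = `|x|.
Proof. by rewrite /= expr0n addr0 sqrtr_sqr. Qed.

Lemma cabs_sum (I : Type) (s : seq I) (F : I -> R[i]) :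
  cabs (\sum_(k <- s) F k) <= \sum_(k <- s) cabs (F k).
Proof.
elim: s => [|x s IH]; first by rewrite !big_nil Normc.normc0.
by rewrite !big_cons; apply: le_trans (le_normcD _ _) _; rewrite lerD2l.
Qed.

Lemma sqnD_le z w : sqn (z + w) <= 2 * sqn z + 2 * sqn w.
Proof.
case: z w => a b [c d]; rewrite /sqn /=.
have := sqr_ge0 (a - c); have := sqr_ge0 (b - d); nra.
Qed.

(** The sum of (x k - t)^2 w k is a nonnegative quadratic in t, evaluated at its minimiser A / W. If
    W = 0 it is affine in t, which forces A = 0. *)
Lemma weighted_cauchy_schwarz (I : Type) (s : seq I) (x w : I -> R) :
  (forall k, 0 <= w k) ->
  (\sum_(k <- s) x k * w k) ^+ 2 <= (\sum_(k <- s) w k) * \sum_(k <- s) x k ^+ 2 * w k.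
Proof.
move=> w0; set A := \sum_(k <- s) x k * w k; set W := \sum_(k <- s) w k.
set B := \sum_(k <- s) x k ^+ 2 * w k.
have H t : 0 <= B - 2 * t * A + t ^+ 2 * W.
  have -> : B - 2 * t * A + t ^+ 2 * W = \sum_(k <- s) (x k - t) ^+ 2 * w k.
    rewrite /A /B /W !mulr_sumr -sumrN -!big_split/=; apply: eq_bigr => k _; ring.
  by apply: sumr_ge0 => k _; rewrite mulr_ge0// sqr_ge0.
have W0 : 0 <= W by exact: sumr_ge0.
have [W0'|W0'] := eqVneq W 0.
  have [->|A0] := eqVneq A 0; first by rewrite expr0n/= W0' mul0r.
  have := H ((B + 1) / (2 * A)); rewrite W0' mulr0 addr0.
  have -> : B - 2 * ((B + 1) / (2 * A)) * A = -1 by field.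
  by rewrite oppr_ge0 ler10.
have {W0 W0'}W0 : 0 < W by rewrite lt_neqAle eq_sym W0'.
have := H (A / W).
have -> : B - 2 * (A / W) * A + (A / W) ^+ 2 * W = (W * B - A ^+ 2) / W by field; rewrite gt_eqF.
by rewrite pmulr_lge0 ?invr_gt0// subr_ge0.
Qed.

(** Cauchy-Schwarz with the weights w i j costs the row sum S1; after exchanging the sums, the
    column sums contribute S2. *)
Lemma schur_test (I J : eqType) (s : seq I) (t : seq J) (e : I -> J -> R[i])
    (w : I -> J -> R) (S1 S2 : R) (f : J -> R[i]) :
  0 <= S1 -> (forall i j, cabs (e i j) <= w i j) ->
  (forall i, \sum_(j <- t) w i j <= S1) -> (forall j, \sum_(i <- s) w i j <= S2) ->
  \sum_(i <- s) sqn (\sum_(j <- t) f j * e i j) <= S1 * S2 * \sum_(j <- t) sqn (f j).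
Proof.
move=> S10 ew h1 h2; have w0 i j : 0 <= w i j by apply: le_trans (ew i j); exact: cabs_ge0.
apply: (@le_trans _ _ (\sum_(i <- s) S1 * \sum_(j <- t) sqn (f j) * w i j)).
  apply: ler_sum => i _; rewrite sqnE.
  apply: (@le_trans _ _ ((\sum_(j <- t) cabs (f j) * w i j) ^+ 2)).
    apply: lerXn2r; rewrite ?nnegrE ?cabs_ge0//.
      by apply: sumr_ge0 => j _; rewrite mulr_ge0// cabs_ge0.
    apply: le_trans (cabs_sum _ _) _; apply: ler_sum => j _.
    by rewrite Normc.normcM ler_wpM2l// cabs_ge0.
  have -> : \sum_(j <- t) sqn (f j) * w i j = \sum_(j <- t) cabs (f j) ^+ 2 * w i j.
    by apply: eq_bigr => j _; rewrite sqnE.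
  apply: le_trans (weighted_cauchy_schwarz _ _ _) _ => //.
  by apply: ler_wpM2r => //; apply: sumr_ge0 => j _; rewrite mulr_ge0// sqr_ge0.
rewrite -mulr_sumr -mulrA ler_wpM2l// exchange_big/= mulr_sumr.
apply: ler_sum => j _; rewrite -mulr_sumr mulrC ler_wpM2r ?sqn_ge0//.
Qed.
End Modulus.

Section ESum.
Variables (R : realType) (T : choiceType) (a : T -> R).
Hypothesis a0 : forall x, 0 <= a x.
Local Open Scope classical_set_scope.

Lemma esum_ge_seq (s : seq T) : uniq s ->
  ((\sum_(x <- s) a x)%:E <= \esum_(x in [set: T]) (a x)%:E)%E.
Proof.
move=> us; apply: esum_ge; exists [set` s].
  by split; [exact: finite_seq|by []].
by rewrite -sumEFin fsbig_seq.
Qed.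

Lemma esum_le_seq (b : \bar R) : (forall s : seq T, uniq s -> ((\sum_(x <- s) a x)%:E <= b)%E) ->
  (\esum_(x in [set: T]) (a x)%:E <= b)%E.
Proof.
move=> H; apply: ub_ereal_sup => _ [A [fA _] <-].
rewrite fsbig_finite//= sumEFin; apply: H; exact: finmap.fset_uniq.
Qed.

Lemma esum_fin (B : R) : (\esum_(x in [set: T]) (a x)%:E <= B%:E)%E ->
  exists N : R, [/\ \esum_(x in [set: T]) (a x)%:E = N%:E,
    forall s : seq T, uniq s -> \sum_(x <- s) a x <= N &
    forall eps, 0 < eps -> exists s : seq T, uniq s /\ N - eps < \sum_(x <- s) a x].
Proof.
move=> hB.
have fin : \esum_(x in [set: T]) (a x)%:E \is a fin_num.
  rewrite ge0_fin_numE ?(le_lt_trans hB) ?ltry//.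
  by apply: esum_ge0 => x _; rewrite lee_fin.
exists (fine (\esum_(x in [set: T]) (a x)%:E)); split; first by rewrite fineK.
  by move=> s us; rewrite -lee_fin fineK//; exact: esum_ge_seq.
move=> eps eps0; apply: contrapT => no.
have : (\esum_(x in [set: T]) (a x)%:E <= (fine (\esum_(x in [set: T]) (a x)%:E) - eps)%:E)%E.
  apply: esum_le_seq => s us; rewrite lee_fin leNgt; apply/negP => h; apply: no.
  by exists s.
by rewrite -{1}(fineK fin) lee_fin lerBrDr gerDl leNgt eps0.
Qed.
End ESum.

Lemma sum_subset (T : eqType) (V : nmodType) (F : T -> V) (a b : seq T) :
  uniq a -> uniq b -> {subset a <= b} ->
  \sum_(n <- b) F n = \sum_(n <- a) F n + \sum_(n <- b | n \notin a) F n.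
Proof.
move=> ua ub ab; rewrite [LHS](bigID (mem a))/=; congr (_ + _).
rewrite -big_filter; apply: perm_big.
by apply: uniq_perm; rewrite ?filter_uniq// => x; rewrite mem_filter; case: (boolP (x \in a)) =>
    //= /ab.
Qed.

Section Ell2.
Variable R : realType.
Local Notation C := R[i].
Local Open Scope classical_set_scope.
Implicit Types (f h : int -> C).

Definition cvgC (u : nat -> C) (z : C) :=
  (fun n => complex.Re (u n)) @ \oo --> (complex.Re z) /\
  (fun n => complex.Im (u n)) @ \oo --> (complex.Im z).

Lemma cvgC_cst z : cvgC (fun=> z) z.
Proof. by split; exact: cvg_cst. Qed.

Lemma ReD (z w : C) : complex.Re (z + w) = complex.Re z + complex.Re w.
Proof. by case: z w => a b []. Qed.
Lemma ImD (z w : C) : complex.Im (z + w) = complex.Im z + complex.Im w.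
Proof. by case: z w => a b []. Qed.

Lemma cvgCD u v z w : cvgC u z -> cvgC v w -> cvgC (fun n => u n + v n) (z + w).
Proof.
move=> [u1 u2] [v1 v2]; split.
  by under eq_fun do rewrite ReD; rewrite ReD; exact: cvgD.
by under eq_fun do rewrite ImD; rewrite ImD; exact: cvgD.
Qed.

Lemma cvgCMr u z w : cvgC u z -> cvgC (fun n => u n * w) (z * w).
Proof.
move=> [u1 u2]; split.
  have E (x : C) : complex.Re (x * w) = complex.Re x * complex.Re w - complex.Im x * complex.Im w.
    by case: x w {u1 u2} => a b [].
  under eq_fun do rewrite E; rewrite E.
  by apply: cvgB; apply: cvgM => //; exact: cvg_cst.
have E (x : C) : complex.Im (x * w) = complex.Re x * complex.Im w + complex.Im x * complex.Re w.
  by case: x w {u1 u2} => a b [].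
under eq_fun do rewrite E; rewrite E.
by apply: cvgD; apply: cvgM => //; exact: cvg_cst.
Qed.

Lemma cvgC_sum (I : Type) (s : seq I) (u : I -> nat -> C) (z : I -> C) :
  (forall k, cvgC (u k) (z k)) ->
  cvgC (fun n => \sum_(k <- s) u k n) (\sum_(k <- s) z k).
Proof.
move=> H; elim: s => [|k s IH].
  by rewrite big_nil; under eq_fun do rewrite big_nil; exact: cvgC_cst.
by rewrite big_cons; under eq_fun do rewrite big_cons; exact: cvgCD.
Qed.

Lemma cvgC_unique u z w : cvgC u z -> cvgC u w -> z = w.
Proof.
move=> [u1 u2] [v1 v2]; have := cvg_unique _ u1 v1; have := cvg_unique _ u2 v2.
by case: z w {u1 u2 v1 v2} => a b [c d] /= -> // ->.
Qed.

Lemma cvgC_sqn u z : cvgC u z -> (fun n => sqn (u n)) @ \oo --> sqn z.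
Proof. by move=> [u1 u2]; apply: cvgD; rewrite /= expr2; under eq_fun do rewrite expr2; exact:
    cvgM. Qed.

Lemma cvg_sum (I : Type) (s : seq I) (u : I -> nat -> R) (z : I -> R) :
  (forall k, u k @ \oo --> z k) ->
  (fun n => \sum_(k <- s) u k n) @ \oo --> \sum_(k <- s) z k.
Proof.
move=> H; elim: s => [|k s IH].
  by rewrite big_nil; under eq_fun do rewrite big_nil; exact: cvg_cst.
by rewrite big_cons; under eq_fun do rewrite big_cons; apply: cvgD.
Qed.

Lemma symsumE (V : int -> C) N : symsum V N = \sum_(n <- zrange N) V n.
Proof. by rewrite /symsum big_map -[X in iota 0 X]subn0 -/(index_iota _ _) big_mkord. Qed.

Lemma zrange_sum_ge0 (v : int -> R) : (forall n, 0 <= v n) ->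
  nondecreasing_seq (fun N => \sum_(n <- zrange N) v n).
Proof.
move=> v0; apply/nondecreasing_seqP => N.
rewrite [leRHS](sum_subset v (zrange_uniq N) (zrange_uniq N.+1)).
  by rewrite lerDl; exact: sumr_ge0.
by move=> x; rewrite !mem_zrange; lia.
Qed.

(** Both b and b + u have nondecreasing bounded partial sums, and u is their difference. *)
Lemma cvg_symsum_abs (u b : int -> R) (B : R) : (forall n, `|u n| <= b n) ->
  (forall N, \sum_(n <- zrange N) b n <= B) -> cvgn (fun N => \sum_(n <- zrange N) u n).
Proof.
move=> ub bB.
have cv (v : int -> R) (D : R) : (forall n, 0 <= v n) -> (forall N, \sum_(n <- zrange N) v n <= D)
    ->
    cvgn (fun N => \sum_(n <- zrange N) v n).
  move=> v0 vD; apply: nondecreasing_is_cvgn; first exact: zrange_sum_ge0.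
  by exists D => _ [N _ <-]; exact: vD.
have c1 : cvgn (fun N => \sum_(n <- zrange N) b n).
  by apply: (cv _ B) => // n; apply: le_trans (ub n).
have c2 : cvgn (fun N => \sum_(n <- zrange N) (b n + u n)).
  apply: (cv _ (B + B)) => [n|N]; first by have := ub n; rewrite ler_norml => /andP[+ _]; lra.
  rewrite big_split/=; apply: lerD; first exact: bB.
  apply: le_trans (bB N); apply: ler_sum => n _; exact: le_trans (ler_norm _) (ub n).
rewrite (_ : (fun N => _) = fun N => \sum_(n <- zrange N) (b n + u n) - \sum_(n <- zrange N) b n).
  exact: is_cvgB.
by apply/funext => N; rewrite [X in _ = X - _]big_split/= addrAC subrr add0r.
Qed.

Lemma in_l2P f : in_l2 f -> exists N : R, [/\ l2norm2 f = N%:E,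
    forall s : seq int, uniq s -> \sum_(n <- s) sqn (f n) <= N &
    forall eps, 0 < eps -> exists s : seq int, uniq s /\ N - eps < \sum_(n <- s) sqn (f n)].
Proof.
move=> fl2; apply: (@esum_fin _ _ (fun n => sqn (f n)) (fun n => sqn_ge0 _) (fine (l2norm2 f))).
rewrite fineK// ge0_fin_numE//; apply: esum_ge0 => n _; by rewrite lee_fin sqn_ge0.
Qed.

Lemma cvgC_ip f h : in_l2 f -> in_l2 h ->
  cvgC (fun N => \sum_(n <- zrange N) f n * (h n)^*) (ip f h).
Proof.
move=> /in_l2P[A [_ fA _]] /in_l2P[B [_ hB _]].
pose b n := sqn (f n) + sqn (h n).
have bB N : \sum_(n <- zrange N) b n <= A + B.
  by rewrite big_split/= lerD// ?fA ?hB// zrange_uniq.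
have Re_sum N (V : int -> C) : complex.Re (\sum_(n <- zrange N) V n) = \sum_(n <- zrange N)
    complex.Re (V n).
  by elim: (zrange N) => [|n s IH]; rewrite ?big_nil// !big_cons ReD IH.
have Im_sum N (V : int -> C) : complex.Im (\sum_(n <- zrange N) V n) = \sum_(n <- zrange N)
    complex.Im (V n).
  by elim: (zrange N) => [|n s IH]; rewrite ?big_nil// !big_cons ImD IH.
have reb n : `|complex.Re (f n * (h n)^*)| <= b n.
  rewrite /b /sqn; case: (f n) (h n) => x y [z w] /=.
  have := sqr_ge0 (x - z); have := sqr_ge0 (x + z); have := sqr_ge0 (y - w); have := sqr_ge0 (y +
      w).
  by rewrite ler_norml; move=> *; apply/andP; split; nra.
have imb n : `|complex.Im (f n * (h n)^*)| <= b n.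
  rewrite /b /sqn; case: (f n) (h n) => x y [z w] /=.
  have := sqr_ge0 (x - w); have := sqr_ge0 (x + w); have := sqr_ge0 (y - z); have := sqr_ge0 (y +
      z).
  by rewrite ler_norml; move=> *; apply/andP; split; nra.
split; rewrite /ip/=.
  rewrite (_ : (fun N => complex.Re (symsum _ N) : R^o) = fun N => complex.Re (\sum_(n <- zrange N)
      f n * (h n)^*)).
    under eq_fun do rewrite Re_sum; exact: cvg_symsum_abs reb bB.
  by apply/funext => N; rewrite symsumE.
rewrite (_ : (fun N => complex.Im (symsum _ N) : R^o) = fun N => complex.Im (\sum_(n <- zrange N) f
    n * (h n)^*)).
  under eq_fun do rewrite Im_sum; exact: cvg_symsum_abs imb bB.
by apply/funext => N; rewrite symsumE.
Qed.

Section Systems.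
Variable I : choiceType.
Implicit Types e g : I -> int -> C.

(** Bounds of the analysis operator, and below of the synthesis operator, stated on finite sections
    so that no convergence is involved. *)
Definition bessel (B : R) e := forall (s : seq I) (t : seq int) f, uniq s -> uniq t ->
  \sum_(i <- s) sqn (\sum_(n <- t) f n * (e i n)^*) <= B * \sum_(n <- t) sqn (f n).

Definition synthesis (B : R) e := forall (s : seq I) (t : seq int) (c : I -> C), uniq s -> uniq t ->
  \sum_(n <- t) sqn (\sum_(i <- s) c i * e i n) <= B * \sum_(i <- s) sqn (c i).

(** The resolution of the identity by e and g, required on each block [-T, T] as an exact finite
    sum. Gabor systems satisfy it when one of the two windows is finitely supported and dual to the
    other. *)
Definition resolves e g := forall T : nat, exists s : seq I, uniq s /\
  forall n n', n \in zrange T -> n' \in zrange T ->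
    \sum_(i <- s) (g i n')^* * e i n = (n == n')%:R.

Lemma bessel_ip (B : R) e f (N : R) s : 0 <= B -> (forall i, in_l2 (e i)) -> bessel B e ->
  in_l2 f -> (forall t, uniq t -> \sum_(n <- t) sqn (f n) <= N) -> uniq s ->
  \sum_(i <- s) sqn (ip f (e i)) <= B * N.
Proof.
move=> B0 el2 eB fl2 fN us.
have H := @cvg_sum _ s _ _ (fun i => cvgC_sqn (cvgC_ip fl2 (el2 i))).
rewrite -(cvg_lim _ H)//; apply: limr_le; first by apply/cvg_ex; eexists; exact: H.
apply: nearW => T; apply: le_trans (eB _ _ _ us (zrange_uniq T)) _.
by rewrite ler_wpM2l// fN// zrange_uniq.
Qed.

(** The truncation of f to [-T, T] is synthesised on that block from its own coefficients c i, so
    its energy is at most Be times theirs. By the Bessel bound, c i differs from [ip f (g i)] only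
    by the energy of the tail of f, which vanishes as T grows; the factor 2 comes from splitting the
    square. No infinite sums are exchanged. *)
Lemma frame_lower (Be Bg : R) e g f (N X : R) : 0 <= Be -> 0 <= Bg -> (forall i, in_l2 (g i)) ->
  synthesis Be e -> bessel Bg g -> resolves e g -> in_l2 f ->
  (forall t, uniq t -> \sum_(n <- t) sqn (f n) <= N) ->
  (forall eps, 0 < eps -> exists t : seq int, uniq t /\ N - eps < \sum_(n <- t) sqn (f n)) ->
  (forall s, uniq s -> \sum_(i <- s) sqn (ip f (g i)) <= X) ->
  N <= 2 * Be * X.
Proof.
move=> Be0 Bg0 gl2 eB gB res fl2 fN fN' fX.
have key T : \sum_(n <- zrange T) sqn (f n) <=
    Be * (2 * X + 2 * (Bg * (N - \sum_(n <- zrange T) sqn (f n)))).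
  have [s [us sE]] := res T.
  pose c i := \sum_(n <- zrange T) f n * (g i n)^*.
  apply: (@le_trans _ _ (Be * \sum_(i <- s) sqn (c i))).
    apply: le_trans (eB s (zrange T) c us (zrange_uniq T)); rewrite big_seq [leRHS]big_seq.
    apply: ler_sum => n nT; rewrite (_ : \sum_(i <- s) _ = f n)//.
    under eq_bigr do rewrite /c mulr_suml; rewrite exchange_big/=.
    transitivity (\sum_(n' <- zrange T) f n' * (n == n')%:R).
      rewrite big_seq [RHS]big_seq; apply: eq_bigr => n' n'T.
      by under eq_bigr do rewrite -mulrA; rewrite -mulr_sumr sE.
    rewrite (bigD1_seq n nT (zrange_uniq T))/= eqxx mulr1 big1 ?addr0// => n'.
    by rewrite eq_sym => /negPf ->; rewrite mulr0.
  apply: ler_wpM2l => //.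
  have H := @cvg_sum _ s _ _ (fun i => cvgC_sqn (cvgC_ip fl2 (gl2 i))).
  suff : \sum_(i <- s) sqn (c i) - 2 * (Bg * (N - \sum_(n <- zrange T) sqn (f n))) <= 2 * X by lra.
  apply: (@le_trans _ _ (2 * \sum_(i <- s) sqn (ip f (g i)))); last by rewrite ler_wpM2l// fX.
  rewrite -ler_pdivrMl// -(cvg_lim _ H)//.
  apply: limr_ge; first by apply/cvg_ex; eexists; exact: H.
  exists T => // T' /= TT'.
  rewrite ler_pdivrMl// lerBlDr.
  have sub : {subset zrange T <= zrange T'} by move=> n; rewrite !mem_zrange; lia.
  have := gB s [seq n <- zrange T' | n \notin zrange T] f us (filter_uniq _ (zrange_uniq _)).
  rewrite !big_filter => h.
  have h2 : \sum_(n <- zrange T' | n \notin zrange T) sqn (f n) <= N - \sum_(n <- zrange T) sqn (f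
      n).
    by rewrite lerBrDl -sum_subset ?zrange_uniq// fN ?zrange_uniq.
  have := le_trans h (ler_wpM2l Bg0 h2).
  move=> h3; apply: le_trans (_ : _ <= 2 * \sum_(i <- s) sqn (\sum_(n <- zrange T') f n * (g i
      n)^*) + 2 * \sum_(i <- s) sqn (\sum_(n <- zrange T' | n \notin zrange T) f n * (g i n)^*)) _;
      last first.
    rewrite lerD2l ler_pM2l//; apply: le_trans h3; apply: ler_sum => i _; by rewrite big_filter.
  rewrite !mulr_sumr -big_split/=; apply: ler_sum => i _.
  have -> : c i = \sum_(n <- zrange T') f n * (g i n)^* + - \sum_(n <- zrange T' | n \notin zrange
      T) f n * (g i n)^*.
    rewrite [X in X - _](bigID (mem (zrange T)))/= addrK /c -[RHS]big_filter.
    apply: perm_big; apply: uniq_perm; rewrite ?filter_uniq ?zrange_uniq// => n.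
    by rewrite mem_filter; case: (boolP (n \in zrange T)) => //= /sub.
  apply: le_trans (sqnD_le _ _) _.
  by rewrite lerD2l ler_wpM2l// /sqn; case: (\sum_(n <- _ | _) _) => x y /=; rewrite !sqrrN.
rewrite leNgt; apply/negP => NX.
(* A tail below eps in [key] gives N < 2 Be X + (1 + 2 Be Bg) eps, which is the midpoint of 2 Be X
   and N. *)
pose eps := (N - 2 * Be * X) / (2 * (1 + 2 * Be * Bg)).
have D0 : 0 < 1 + 2 * Be * Bg by rewrite ltr_pwDl// !mulr_ge0.
have eps0 : 0 < eps by rewrite divr_gt0 ?subr_gt0// mulr_gt0.
have [t [ut tN]] := fN' _ eps0.
pose T := \max_(n <- t) absz n.
have tT : {subset t <= zrange T}.
  by move=> n nt; rewrite mem_zrange; have : (absz n <= T)%N by exact: leq_bigmax_seq; lia.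
have h1 : N - \sum_(n <- zrange T) sqn (f n) < eps.
  have := sum_subset (fun n => sqn (f n)) ut (zrange_uniq T) tT.
  have : 0 <= \sum_(n <- zrange T | n \notin t) sqn (f n) by apply: sumr_ge0 => n _; exact: sqn_ge0.
  lra.
have := key T; set Y := \sum_(n <- _) _ in h1 *.
have epsE : 2 * eps * (1 + 2 * Be * Bg) = N - 2 * Be * X.
  by rewrite /eps; field; rewrite gt_eqF.
have BB : 0 <= Be * Bg by rewrite mulr_ge0.
nra.
Qed.
End Systems.
End Ell2.

Section Frames.
Variables (R : realType) (I : choiceType).
Local Notation C := R[i].
Implicit Types e g : I -> int -> C.

Lemma resolves_sym e g : resolves e g -> resolves g e.
Proof.
move=> res T; have [s [us sE]] := res T; exists s; split => // n n' nT n'T.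
rewrite -[RHS]conjc_nat eq_sym -(sE n' n n'T nT) rmorph_sum/=.
by apply: eq_bigr => i _; rewrite rmorphM/= conjcK mulrC.
Qed.

Lemma frame_intro (Be Bg : R) e g : 0 < Be -> 0 < Bg -> (forall i, in_l2 (e i)) ->
  bessel Be e -> synthesis Bg g -> resolves g e -> is_frame e.
Proof.
move=> Be0 Bg0 el2 eB gB res; split => //.
exists (2 * Bg)^-1, Be; split; first by rewrite invr_gt0 mulr_gt0.
split => // f fl2; have [N [fE fN fN']] := in_l2P fl2.
have Bub : (\esum_(i in [set: I]%classic) (sqn (ip f (e i)))%:E <= (Be * N)%:E)%E.
  apply: esum_le_seq => s us.
  by rewrite lee_fin; apply: (bessel_ip (ltW Be0) el2 eB fl2).
have [X [XE eX _]] := esum_fin (fun i => sqn_ge0 (ip f (e i))) Bub.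
rewrite XE fE -!EFinM !lee_fin; split; last by move: Bub; rewrite XE lee_fin.
rewrite ler_pdivrMl ?mulr_gt0//.
exact: (frame_lower (ltW Bg0) (ltW Be0) el2 gB eB res fl2).
Qed.
End Frames.

(** * Roots of unity *)

Section Expj.
Variable R : realType.
Local Notation C := R[i].

Lemma expjD (x y : R) : expj (x + y) = expj x * expj y.
Proof.
rewrite /expj cosD sinD; apply/eqP; rewrite eq_complex/= eqxx/=.
by rewrite addrC eqxx.
Qed.

Lemma expj0 : expj (0 : R) = 1.
Proof. by rewrite /expj cos0 sin0. Qed.

Lemma expjJ (x : R) : (expj x)^* = expj (- x).
Proof. by rewrite /expj cosN sinN. Qed.

Lemma expj_muln (x : R) n : expj (x * n%:R) = expj x ^+ n.
Proof.
elim: n => [|n IH]; first by rewrite mulr0 expj0.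
by rewrite -natr1 mulrDr mulr1 expjD IH exprSr.
Qed.

Lemma expj_2pi : expj (2 * pi : R) = 1.
Proof. by rewrite mulr_natl /expj cos2pi sin2pi. Qed.

Lemma expj_int (k : int) : expj (2 * pi * k%:~R : R) = 1.
Proof.
case: k => n; first by rewrite -pmulrn expj_muln expj_2pi expr1n.
rewrite NegzE rmorphN/= mulrN -expjJ -pmulrn expj_muln expj_2pi expr1n; exact: conjc1.
Qed.

Lemma expj_neq1 (x : R) : 0 < x < 2 * pi -> expj x != 1.
Proof.
move=> /andP[x0 x2]; apply/eqP => /(congr1 (@complex.Re R)) /= cx.
have s0 : 0 < sin (x / 2) by apply: sin_gt0_pi; apply/andP; split; lra.
have : cos x = cos ((x / 2) *+ 2) by congr cos; rewrite -mulr_natr; field.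
rewrite cos_mulr2n cx cos2sin2 => h; have := exprn_gt0 2 s0; lra.
Qed.

Lemma root_sum (M : nat) (t : int) : (0 < M)%N ->
  \sum_(l < M) expj (2 * pi * (l%:R / M%:R) * t%:~R : R) = if (M%:Z %| t)%Z then M%:R else 0.
Proof.
move=> M0; have M0' : M%:R != 0 :> R by rewrite pnatr_eq0 -lt0n.
pose z := expj (2 * pi * (t%:~R / M%:R) : R).
have -> : \sum_(l < M) expj (2 * pi * (l%:R / M%:R) * t%:~R : R) = \sum_(l < M) z ^+ l.
  apply: eq_bigr => l _; rewrite -expj_muln; congr expj; field; exact: M0'.
have zM : z ^+ M = 1.
  by rewrite -expj_muln (_ : _ * _ = 2 * pi * t%:~R) ?expj_int//; field.
case: ifP => [/dvdzP[q tE]|Mt].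
  have -> : z = 1.
    rewrite /z tE rmorphM/= (_ : _ * (_ / _) = 2 * pi * q%:~R) ?expj_int//.
    by rewrite -pmulrn mulfK.
  by under eq_bigr do rewrite expr1n; rewrite sumr_const card_ord.
have z1 : z != 1.
  pose r := (t %% M%:Z)%Z; have MZ : M%:Z != 0 by lia.
  have r0 : 0 < r.
    rewrite lt_neqAle modz_ge0// andbT eq_sym; apply/eqP => r0.
    by move/negP: Mt; apply; apply/dvdz_mod0P.
  have rM : r < M%:Z by rewrite ltz_mod.
  have -> : z = expj (2 * pi * (r%:~R / M%:R)).
    have tE : t%:~R / M%:R = (t %/ M%:Z)%Z%:~R + r%:~R / M%:R :> R.
      by rewrite {1}(divz_eq t M%:Z) -/r intrD intrM -pmulrn mulrDl mulfK.
    by rewrite /z tE mulrDr expjD expj_int mul1r.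
  apply: expj_neq1; have pi0 := pi_gt0 R.
  have rR : 0 < r%:~R :> R by rewrite ltr0z.
  have MR : 0 < M%:R :> R by rewrite ltr0n.
  have rM' : r%:~R / M%:R < 1 :> R by rewrite ltr_pdivrMr// mul1r pmulrn ltr_int.
  have := divr_gt0 rR MR; move: rM'; move: (r%:~R / M%:R) => x x1 x0; apply/andP; split; nra.
apply/eqP; rewrite -(mulrI_eq0 _ (mulfI (_ : z - 1 != 0))) ?subr_eq0//.
by rewrite -subrX1 zM subrr.
Qed.
End Expj.

(** * Gabor systems *)

Section Gabor.
Variables (R : realType) (a M : nat).
Hypotheses (a0 : (0 < a)%N) (M0 : (0 < M)%N).
Local Notation C := R[i].
Implicit Types h th : int -> R.
Local Notation seqC h := (fun k : int => (h k)%:C).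

Definition l1_bounded (S : R) h := forall s : seq int, uniq s -> \sum_(n <- s) `|h n| <= S.

Lemma l1_bounded_ge0 S h : l1_bounded S h -> 0 <= S.
Proof. by move=> /(_ [::] isT); rewrite big_nil. Qed.

Lemma gaborE h k (l : 'I_M) n : gabor (seqC h) a M (k, l) n =
  (h (n - k * a%:Z))%:C * expj (2 * pi * (l%:R / M%:R) * n%:~R).
Proof. by []. Qed.

Lemma cabs_gabor h k (l : 'I_M) n : Normc.normc (gabor (seqC h) a M (k, l) n) = `|h (n - k * a%:Z)|.
Proof. by rewrite /gabor Normc.normcM cabs_expj mulr1 cabs_real. Qed.

Lemma gabor_row_sum S h (t : seq int) (kl : int * 'I_M) : l1_bounded S h -> uniq t ->
  \sum_(n <- t) `|h (n - kl.1 * a%:Z)| <= S.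
Proof.
move=> hS ut; rewrite -(big_map (fun n => n - kl.1 * a%:Z) xpredT (fun n => `|h n|)).
by apply: hS; rewrite map_inj_uniq// => x y /addIr.
Qed.

(** For each of the M modulations the points n - k a are distinct, whence the factor M. *)
Lemma gabor_col_sum S h (s : seq (int * 'I_M)) (n : int) : l1_bounded S h -> uniq s ->
  \sum_(i <- s) `|h (n - i.1 * a%:Z)| <= M%:R * S.
Proof.
move=> hS us.
rewrite (partition_big (fun i : int * 'I_M => i.2) xpredT)//=.
rewrite -[M in leRHS]card_ord mulr_natl -sumr_const; apply: ler_sum => l _.
rewrite -big_filter -(big_map (fun i : int * 'I_M => n - i.1 * a%:Z) xpredT (fun n => `|h n|)).
apply: hS; rewrite map_inj_in_uniq ?filter_uniq// => -[k1 l1] [k2 l2].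
rewrite !mem_filter /= => /andP[/eqP -> _] /andP[/eqP -> _] /addrI /oppr_inj.
have aZ : a%:Z != 0 by lia.
by move=> /(mulIf aZ) ->.
Qed.

Lemma l1_in_l2 S h (f : int -> C) : l1_bounded S h ->
  (forall n, Normc.normc (f n) = `|h n|) -> in_l2 f.
Proof.
move=> hS fh; apply: (@le_lt_trans _ _ (S ^+ 2)%:E); last exact: ltry.
apply: esum_le_seq => s us; rewrite lee_fin.
apply: (@le_trans _ _ (\sum_(n <- s) S * `|h n|)).
  apply: ler_sum => n _; rewrite sqnE fh expr2 ler_wpM2r//.
  by have := hS [:: n] isT; rewrite big_seq1.
by rewrite -mulr_sumr expr2 ler_wpM2l ?hS//; exact: l1_bounded_ge0 hS.
Qed.

Lemma gabor_in_l2 S h i : l1_bounded S h -> in_l2 (gabor (seqC h) a M i).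
Proof.
case: i => k l hS; apply: (@l1_in_l2 S (fun n => h (n - k * a%:Z))); last exact: cabs_gabor.
by move=> s us; exact: (gabor_row_sum (k, l) hS us).
Qed.

Lemma gabor_bessel S h : l1_bounded S h -> bessel (S * (M%:R * S)) (gabor (seqC h) a M).
Proof.
move=> hS s t f us ut.
apply: (@schur_test _ _ _ s t (fun i n => (gabor (seqC h) a M i n)^*)
   (fun i n => `|h (n - i.1 * a%:Z)|)).
- exact: l1_bounded_ge0 hS.
- by move=> [k l] n; rewrite cabsJ cabs_gabor.
- by move=> i; exact: gabor_row_sum.
- by move=> n; exact: gabor_col_sum.
Qed.

Lemma gabor_synthesis S h : l1_bounded S h -> synthesis (M%:R * S * S) (gabor (seqC h) a M).
Proof.
move=> hS s t f us ut.
apply: (@schur_test _ _ _ t s (fun n i => gabor (seqC h) a M i n)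
   (fun n i => `|h (n - i.1 * a%:Z)|)).
- by rewrite mulr_ge0//; exact: l1_bounded_ge0 hS.
- by move=> n [k l]; rewrite cabs_gabor.
- by move=> n; exact: gabor_col_sum.
- by move=> i; exact: gabor_row_sum.
Qed.

Definition gabor_range (K : nat) : seq (int * 'I_M) :=
  [seq (k, l) | k <- zrange K, l <- enum 'I_M].

Lemma gabor_range_uniq K : uniq (gabor_range K).
Proof. by apply: allpairs_uniq => [||[? ?] [? ?]]; rewrite ?zrange_uniq ?enum_uniq. Qed.

Lemma mem_gabor_range K i : (i \in gabor_range K) = (i.1 \in zrange K).
Proof.
case: i => k l; apply/allpairsP/idP => [[[k' l'] /= [? _ [-> _]]//]|kK].
by exists (k, l); split => //; exact: mem_enum.
Qed.

Lemma sum_gabor_range (V : nmodType) K (F : int * 'I_M -> V) :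
  \sum_(i <- gabor_range K) F i = \sum_(k <- zrange K) \sum_(l < M) F (k, l).
Proof. by rewrite big_allpairs; apply: eq_bigr => k _; rewrite big_enum. Qed.

(* The Wexler-Raz condition for the step [b] and [N] modulations, up to the factor [1 / N]. The
   window [th] is to vanish outside [-N0, N0], so that [|n0| + N0 <= K] makes the sum complete. *)
Definition dual_pair (b N : nat) (N0 : nat) h th := forall (n0 p : int) (K : nat),
  `|n0| + N0%:Z <= K%:Z ->
  \sum_(k <- zrange K) h (n0 + p * N%:Z - k * b%:Z) * th (n0 - k * b%:Z) = (p == 0)%:R.

(* In the scope of a product, [^*] is [Num.conj] rather than [conjc]. *)
Lemma conjM (x y : C) : Num.conj (x * y) = Num.conj x * Num.conj y.
Proof. exact: rmorphM. Qed.

Lemma conj_expj (x : R) : Num.conj (expj x) = expj (- x).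
Proof. exact: expjJ. Qed.

Lemma conj_real (x : R) : Num.conj (x%:C : C) = x%:C.
Proof. exact: conjc_real. Qed.

Lemma realCM (x y : R) : (x * y)%:C = x%:C * y%:C.
Proof. exact: rmorphM. Qed.

(** The sum over the modulations is M if M divides n - n' and 0 otherwise; in the first case n' = n
    + p M and the sum over k is the Wexler-Raz sum for p. *)
Lemma gabor_kernel N0 h th (n n' : int) K : dual_pair a M N0 h th -> `|n| + N0%:Z <= K%:Z ->
  \sum_(i <- gabor_range K) (gabor (seqC h) a M i n')^* *
     gabor (seqC (fun k => th k / M%:R)) a M i n = (n == n')%:R.
Proof.
move=> dual nK; rewrite sum_gabor_range.
have M0' : M%:R != 0 :> R by rewrite pnatr_eq0 -lt0n.
have E k : \sum_(l < M) (gabor (seqC h) a M (k, l) n')^* * gabor (seqC (fun k => th k / M%:R)) a M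
    (k, l) n
   = (h (n' - k * a%:Z) * th (n - k * a%:Z))%:C * ((M%:R)^-1%:C * (if (M%:Z %| n - n')%Z then M%:R
       else 0)).
  rewrite -(root_sum R (n - n') M0) !mulr_sumr; apply: eq_bigr => l _.
  rewrite !gaborE conjM conj_expj conj_real intrD [_ * (_%:~R + _)]mulrDr expjD mulrNz mulrN
      !realCM.
  ring.
under eq_bigr do rewrite E.
rewrite -mulr_suml -rmorph_sum/=.
case: ifP => [/dvdzP[q qE]|nd].
  have -> : n' = n + (- q) * M%:Z by lia.
  rewrite (dual n (- q) K nK) oppr_eq0.
  have -> : (M%:R : C) = (M%:R : R)%:C by rewrite rmorph_nat.
  rewrite -rmorphM/= mulVf// mulr1 rmorph_nat; congr (_%:R); congr nat_of_bool.
  by apply/eqP/eqP => [->|]; [rewrite oppr0 mul0r addr0|nia].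
rewrite !mulr0; case: eqP => // nn'; move: nd; rewrite nn' subrr dvdz0//.
Qed.

End Gabor.

(** * From dual pairs to dual windows and Riesz bounds *)

Section Duality.
Variables (R : realType).
Local Notation C := R[i].
Local Notation seqC h := (fun k : int => ((h k : R)%:C : R[i])).

Lemma finsupp_l1 (th : int -> R) (N0 : nat) : (forall y, N0%:Z < `|y| -> th y = 0) ->
  l1_bounded (\sum_(n <- zrange N0) `|th n|) th.
Proof.
move=> th0 s us.
have -> : \sum_(n <- s) `|th n| = \sum_(n <- [seq x <- s | x \in zrange N0]) `|th n|.
  rewrite big_filter [RHS]big_mkcond/=; apply: eq_bigr => n _.
  by rewrite mem_zrange; case: leP => // /th0 ->; rewrite normr0.
rewrite [leRHS](sum_subset (fun n => `|th n|) (filter_uniq (mem (zrange N0)) us) (zrange_uniq N0)).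
  by rewrite lerDl; apply: sumr_ge0.
by move=> n; rewrite mem_filter => /andP[].
Qed.

Lemma exp_decay_l1 (h : int -> R) (A l : R) : 0 <= A -> 0 < l ->
  (forall n, `|h n| <= A * expR (- (l * `|n%:~R|))) ->
  l1_bounded (A * (2 * (1 - expR (- l))^-1)) h.
Proof.
move=> A0 l0 hA s us.
pose r := expR (- l); have r0 : 0 < r by exact: expR_gt0.
have r1 : r < 1 by rewrite /r -expR0 ltr_expR oppr_lt0.
apply: (@le_trans _ _ (\sum_(n <- s) A * r ^+ absz n)).
  apply: ler_sum => n _; apply: le_trans (hA n) _; rewrite ler_wpM2l//.
  by rewrite /r -expRM_natl mulrN mulrC pmulrn abszE intr_norm.
rewrite -mulr_sumr ler_wpM2l//.
have geo (u : seq nat) : uniq u -> \sum_(j <- u) r ^+ j <= (1 - r)^-1.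
  move=> uu; pose J := (\max_(j <- u) j).+1.
  apply: (@le_trans _ _ (\sum_(j <- iota 0 J) r ^+ j)).
    rewrite [leRHS](sum_subset (fun j => r ^+ j) uu (iota_uniq _ _)).
      by rewrite lerDl; apply: sumr_ge0 => j _; rewrite exprn_ge0// ltW.
    by move=> j ju; rewrite mem_iota/= add0n ltnS; exact: leq_bigmax_seq.
  rewrite -[X in iota 0 X]subn0 -/(index_iota _ _) big_mkord.
  rewrite -[leRHS]mul1r ler_pdivlMr ?subr_gt0// mulrC.
  rewrite -[1 - r]opprB mulNr -subrX1 opprB lerBlDr lerDl.
  by rewrite exprn_ge0// ltW.
rewrite (bigID (fun n : int => 0 <= n))/= mulrDl mul1r; apply: lerD.
  rewrite -big_filter -(big_map absz xpredT (fun j => r ^+ j)); apply: geo.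
  rewrite map_inj_in_uniq ?filter_uniq// => x y; rewrite !mem_filter => /andP[? _] /andP[? _]; lia.
rewrite -big_filter -(big_map absz xpredT (fun j => r ^+ j)); apply: geo.
rewrite map_inj_in_uniq ?filter_uniq// => x y; rewrite !mem_filter => /andP[? _] /andP[? _]; lia.
Qed.

Section DualWindow.
Variables (a M N0 : nat) (h th : int -> R) (S S' : R).
Hypotheses (a0 : (0 < a)%N) (M0 : (0 < M)%N) (hS : l1_bounded S h) (S0 : 0 < S).
Hypotheses (dual : dual_pair a M N0 h th) (thS : l1_bounded S' (fun k => th k / M%:R)) (S'0 : 0 <
    S').

Local Notation e := (gabor (seqC h) a M).
Local Notation g := (gabor (seqC (fun k => th k / M%:R)) a M).

Lemma gabor_resolves : resolves g e.
Proof.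
move=> T; exists (gabor_range M (T + N0)%N); split; first exact: gabor_range_uniq.
move=> n n' nT n'T; apply: (gabor_kernel a0 M0 n' dual).
by move: nT; rewrite mem_zrange; lia.
Qed.

Lemma gabor_frames : is_frame e /\ is_frame g.
Proof.
have MR : 0 < M%:R :> R by rewrite ltr0n.
split.
  apply: (@frame_intro _ _ (S * (M%:R * S)) (M%:R * S' * S') e g); rewrite ?mulr_gt0//.
  - by move=> i; exact: gabor_in_l2 hS.
  - exact: gabor_bessel.
  - exact: gabor_synthesis.
  - exact: gabor_resolves.
apply: (@frame_intro _ _ (S' * (M%:R * S')) (M%:R * S * S) g e); rewrite ?mulr_gt0//.
- by move=> i; exact: gabor_in_l2 thS.
- exact: gabor_bessel.
- exact: gabor_synthesis.
- by apply: resolves_sym; exact: gabor_resolves.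
Qed.

(** Only the finitely many k with n - k a in the support of [th] contribute at n, so the expansion
    is exact from some K on, and the limits defining the inner products pass through a finite
    sum. *)
Lemma gabor_reconstruct f n K : in_l2 f -> `|n| + N0%:Z <= K%:Z ->
  \sum_(i <- gabor_range M K) ip f (e i) * g i n = f n.
Proof.
move=> fl2 nK.
have el2 i : in_l2 (e i) by exact: gabor_in_l2 hS.
have H := cvgC_sum (gabor_range M K) (fun i => cvgCMr (g i n) (cvgC_ip fl2 (el2 i))).
apply: cvgC_unique H _.
suff E T : `|n| <= T%:Z -> \sum_(i <- gabor_range M K) (\sum_(n' <- zrange T) f n' * (e i n')^*) *
    g i n = f n.
  split; apply: cvg_near_cst; exists (absz n) => // T /= nT; rewrite E//; lia.
move=> nT; under eq_bigr do rewrite mulr_suml; rewrite exchange_big/=.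
transitivity (\sum_(n' <- zrange T) f n' * (n == n')%:R).
  apply: eq_bigr => n' _; under eq_bigr do rewrite -mulrA.
  by rewrite -mulr_sumr (gabor_kernel a0 M0 n' dual nK).
rewrite (bigD1_seq n) ?zrange_uniq ?mem_zrange//= eqxx mulr1 big1 ?addr0// => n'.
by rewrite eq_sym => /negPf ->; rewrite mulr0.
Qed.

(** On a finite set [t] the error is a finite synthesis sum over the indices [w] between K and some
    K' depending on [t]. The synthesis bound reduces it to the coefficient energy on [w], which is
    below eps / Bg uniformly in [t], because K0 is chosen from a set [s] carrying all but that much
    of the energy. *)
Lemma gabor_dual_window : dual_window (seqC h) (seqC (fun k => th k / M%:R)) a M.
Proof.
split; first by have [] := gabor_frames.
move=> f fl2 eps eps0.
have MR : 0 < M%:R :> R by rewrite ltr0n.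
have [N [fE fN _]] := in_l2P fl2.
have el2 i : in_l2 (e i) by exact: gabor_in_l2 hS.
pose Be := S * (M%:R * S); pose Bg := M%:R * S' * S'.
have Be0 : 0 <= Be by rewrite /Be !mulr_ge0// ltW.
have Bg0 : 0 < Bg by rewrite /Bg !mulr_gt0.
have Bub : (\esum_(i in [set: int * 'I_M]%classic) (sqn (ip f (e i)))%:E <= (Be * N)%:E)%E.
  apply: esum_le_seq => s us; rewrite lee_fin.
  exact: (bessel_ip Be0 el2 (gabor_bessel a0 M0 hS) fl2).
have [X [_ eX eX']] := esum_fin (fun i => sqn_ge0 (ip f (e i))) Bub.
have [s [us sX]] := eX' (eps / Bg) (divr_gt0 eps0 Bg0).
pose K0 := \max_(i <- s) absz i.1.
exists K0 => K K0K.
apply: esum_le_seq => t ut; rewrite lee_fin.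
pose T := \max_(n <- t) absz n.
pose K' := (K + T + N0)%N.
pose w := [seq i <- gabor_range M K' | i \notin gabor_range M K].
have uw : uniq w by rewrite filter_uniq// gabor_range_uniq.
have sub : {subset gabor_range M K <= gabor_range M K'}.
  by move=> i; rewrite !mem_gabor_range !mem_zrange; lia.
have E n : n \in t -> f n - symsum (fun k => \sum_(l < M) ip f (e (k, l)) * g (k, l) n) K =
    \sum_(i <- w) ip f (e i) * g i n.
  move=> nt; rewrite symsumE -(sum_gabor_range K (fun i => ip f (e i) * g i n)).
  have nT : (absz n <= T)%N by exact: leq_bigmax_seq.
  rewrite -(@gabor_reconstruct f n K' fl2); last by rewrite /K'; lia.
  rewrite (sum_subset (fun i => ip f (e i) * g i n) (gabor_range_uniq M K) (gabor_range_uniq M K')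
      sub).
  by rewrite addrC addKr big_filter.
rewrite big_seq; under eq_bigr => n nt do rewrite E//; rewrite -big_seq.
apply: le_trans (gabor_synthesis a0 M0 thS (fun i => ip f (e i)) uw ut) _.
rewrite -/Bg -ler_pdivlMl// mulrC.
have ss : {subset s <= gabor_range M K}.
  move=> i is'; rewrite mem_gabor_range mem_zrange.
  have : (absz i.1 <= K0)%N by exact: (@leq_bigmax_seq _ _ xpredT (fun i : int * 'I_M => absz i.1)).
  by move=> h1; rewrite -abszE lez_nat (leq_trans h1 K0K).
have h1 := sum_subset (fun i => sqn (ip f (e i))) us (gabor_range_uniq M K) ss.
have h2 := sum_subset (fun i => sqn (ip f (e i))) (gabor_range_uniq M K) (gabor_range_uniq M K')
    sub.
have h3 := eX _ (gabor_range_uniq M K').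
have h4 : 0 <= \sum_(n <- gabor_range M K | n \notin s) sqn (ip f (e n)).
  by apply: sumr_ge0 => i _; exact: sqn_ge0.
by rewrite /w big_filter; lra.
Qed.
End DualWindow.

Section Riesz.
Variables (a M N0 : nat) (h th : int -> R) (S S' : R).
Hypotheses (a0 : (0 < a)%N) (M0 : (0 < M)%N) (hS : l1_bounded S h) (S0 : 0 < S).
Hypotheses (dual : dual_pair M a N0 h th) (thS : l1_bounded S' (fun k => th k / M%:R)) (S'0 : 0 <
    S').

Local Notation e := (gabor (seqC h) a M).
Local Notation g := (gabor (seqC (fun k => th k / M%:R)) a M).

(** A block of integers arranged by residues: with n = r - q M, the relative modulation of two Gabor
    elements depends on r alone, and the sum over q is a Wexler-Raz sum with step M. *)
Definition residue_range (Q : nat) : seq int :=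
  [seq r%:Z - q * M%:Z | r <- iota 0 M, q <- zrange Q].

Lemma residue_range_uniq Q : uniq (residue_range Q).
Proof.
apply: allpairs_uniq; rewrite ?iota_uniq ?zrange_uniq// => -[r q] [r' q'].
have lt x y : (x, y) \in [seq (x, y) | x <- iota 0 M, y <- zrange Q] -> (x < M)%N.
  by move=> /allpairsP [[x' y'] /= [xM _ [-> _]]]; move: xM; rewrite mem_iota.
move=> /lt rM /lt r'M /= E.
have qq' : q = q' by nia.
by rewrite qq' in E *; congr pair; lia.
Qed.

(** For fixed r the sum over q is the dual pair identity at n0 = r - k' a and p = k' - k, which
    singles out k = k'. The remaining sum over r of roots of unity singles out l = l', and its value
    M cancels the factor 1 / M of the window. *)
Lemma gabor_biorthogonal Q (i i' : int * 'I_M) : (forall r : nat, (r < M)%N -> `|r%:Z - i'.1 *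
    a%:Z| + N0%:Z <= Q%:Z) ->
  \sum_(n <- residue_range Q) e i n * (g i' n)^* = (i == i')%:R.
Proof.
case: i i' => k l [k' l'] /= Qb.
have M0' : M%:R != 0 :> R by rewrite pnatr_eq0 -lt0n.
rewrite big_allpairs_dep/= -[X in iota 0 X]subn0 -/(index_iota _ _) big_mkord.
have E (r : 'I_M) q : e (k, l) (r%:Z - q * M%:Z) * (g (k', l') (r%:Z - q * M%:Z))^* =
   (h (r%:Z - k' * a%:Z + (k' - k) * a%:Z - q * M%:Z) * th (r%:Z - k' * a%:Z - q * M%:Z))%:C *
    (M%:R^-1%:C * expj (2 * pi * (r%:R / M%:R) * (l%:Z - l'%:Z)%:~R)).
  rewrite !gaborE conjM conj_expj conj_real !realCM.
  have -> : r%:Z - q * M%:Z - k * a%:Z = r%:Z - k' * a%:Z + (k' - k) * a%:Z - q * M%:Z by ring.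
  have -> : r%:Z - q * M%:Z - k' * a%:Z = r%:Z - k' * a%:Z - q * M%:Z by ring.
  have -> : expj (2 * pi * (r%:R / M%:R) * (l%:Z - l'%:Z)%:~R : R) =
     expj (2 * pi * (l%:R / M%:R) * (r%:Z - q * M%:Z)%:~R) * expj (- (2 * pi * (l'%:R / M%:R) *
         (r%:Z - q * M%:Z)%:~R)).
    (* Replacing r by r - q M shifts the phase by an integer multiple of 2 pi. *)
    rewrite -expjD -[LHS]mul1r -(expj_int R (- (q * (l%:Z - l'%:Z)))) -expjD; congr expj.
    by rewrite !(intrD, intrM, mulrNz) -!pmulrn; field.
  ring.
under eq_bigr => r _ do under eq_bigr => q _ do rewrite E.
transitivity (\sum_(r < M) (k' - k == 0)%:R * (M%:R^-1%:C * expj (2 * pi * (r%:R / M%:R) * (l%:Z -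
    l'%:Z)%:~R)) : C).
  apply: eq_bigr => r _; rewrite -mulr_suml -rmorph_sum/=; congr (_ * _).
  by rewrite (dual _ (Qb r (ltn_ord r))) rmorph_nat.
rewrite -mulr_sumr -mulr_sumr root_sum//.
have -> : (M%:Z %| l%:Z - l'%:Z)%Z = (l == l').
  apply/dvdzP/eqP => [[q qE]|->]; last by exists 0; rewrite subrr mul0r.
  have lM := ltn_ord l; have l'M := ltn_ord l'; have q0 : q = 0 by nia.
  by apply/val_inj => /=; move: qE; rewrite q0 mul0r; lia.
rewrite subr_eq0 xpair_eqE [k' == k]eq_sym.
case: (l == l'); last by rewrite andbF !mulr0.
have -> : (M%:R : C) = (M%:R : R)%:C by rewrite rmorph_nat.
by rewrite andbT -realCM mulVf// mulr1.
Qed.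

(** Biorthogonality recovers c as the coefficients of the sum of c i e i against [g], so the Bessel
    bound of [g] is the lower Riesz bound. *)
Lemma gabor_riesz : is_riesz_seq e.
Proof.
have MR : 0 < M%:R :> R by rewrite ltr0n.
split; first by move=> i; exact: gabor_in_l2 hS.
pose Be := M%:R * S * S; pose Bg := S' * (M%:R * S').
have Be0 : 0 < Be by rewrite /Be !mulr_gt0.
have Bg0 : 0 < Bg by rewrite /Bg !mulr_gt0.
exists Bg^-1, Be; split; first by rewrite invr_gt0.
split => // s c us; split; last first.
  rewrite -EFinM; apply: esum_le_seq => t ut; rewrite lee_fin.
  exact: gabor_synthesis.
(* Large enough for [gabor_biorthogonal] at every index in [s]. *)
pose Q := (M + (\max_(i <- s) absz i.1) * a + N0)%N.
have lb := @esum_ge_seq R _ (fun n => sqn (\sum_(i <- s) c i * e i n)) _ (residue_range_uniq Q).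
apply: (le_trans _ lb).
rewrite -EFinM lee_fin ler_pdivrMl//.
have := gabor_bessel a0 M0 thS (fun n => \sum_(i <- s) c i * e i n) us (residue_range_uniq Q).
apply: le_trans; rewrite big_seq [leRHS]big_seq; apply: ler_sum => i' i's.
rewrite (_ : \sum_(n <- residue_range Q) _ = c i')//.
under eq_bigr do rewrite mulr_suml; rewrite exchange_big/=.
transitivity (\sum_(i <- s) c i * (i == i')%:R).
  apply: eq_bigr => i _; under eq_bigr do rewrite -mulrA.
  rewrite -mulr_sumr gabor_biorthogonal// => r rM.
  have : (absz i'.1 <= \max_(i <- s) absz i.1)%N by exact: (@leq_bigmax_seq _ _ xpredT (fun i : int
      * 'I_M => absz i.1)).
  rewrite /Q; move: (\max_(i <- s) absz i.1) (i'.1 : int) => mx k kmx.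
  have : (absz (k * a%:Z)%R <= mx * a)%N by rewrite abszM leq_mul.
  move: (k * a%:Z) (mx * a)%N; lia.
rewrite (bigD1_seq i')//= eqxx mulr1 big1 ?addr0// => i.
by move=> /negPf ->; rewrite mulr0.
Qed.
End Riesz.
End Duality.

Lemma l1_bounded_pos (R : realType) (S : R) (h : int -> R) : l1_bounded S h -> l1_bounded (S + 1) h.
Proof. by move=> hS s us; apply: le_trans (hS s us) _; rewrite lerDl. Qed.

(** The dual pair is stated for arbitrary steps because the Riesz case uses it with a and M
    exchanged. The constant c of g is divided out of [th]. *)
Lemma tp_samples (R : realType) (g : R -> R) (m : nat) : (2 <= m)%N ->
  totally_positive_finite_type g m -> continuous g ->
  (exists2 S : R, 0 < S & l1_bounded S (fun k => g k%:~R)) /\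
  forall a M : nat, (0 < a < M)%N -> exists (th : int -> R) (N0 : nat),
    (forall y, N0%:Z < `|y| -> th y = 0) /\ dual_pair a M N0 (fun k => g k%:~R) th.
Proof.
move=> m2 tp cg; have [d [P [Q [c [c0 d0 tow gE]]]]] := tp_structure m2 tp cg.
have [_ E _ jump] := tow.
split.
  have [E1 E2] := E m; have [A [l [A0 l0 bd]]] := two_sided_bounded E1 E2.
  have hS : l1_bounded (c * A * (2 * (1 - expR (- l))^-1)) (fun k => g k%:~R).
    apply: exp_decay_l1 => // [|n]; first by rewrite mulr_ge0// ltW.
    by rewrite gE normrM (gtr0_norm c0) -mulrA ler_wpM2l// ltW.
  have S0 := l1_bounded_ge0 hS.
  by exists (c * A * (2 * (1 - expR (- l))^-1) + 1); [rewrite ltr_wpDl|exact: l1_bounded_pos].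
move=> a M aM.
have [n mE] : {n | m = n.+2} by exists m.-2; lia.
have jmp : P 1%N 0 != Q 1%N 0.
  by rewrite -subr_eq0 jump /= invr_eq0.
have [th [N0 [th0 dual]]] := dual_sequence aM (tower_ladder d0 tow n.+2) jmp (tower_jump d0 tow).
exists (fun y => th y / c), N0; split; first by move=> y /th0 ->; rewrite mul0r.
move=> n0 p K nK; rewrite -(dual n0 p K nK); apply: eq_bigr => k _.
by rewrite gE mE; field; rewrite gt_eqF.
Qed.

Theorem theorem5 (R : realType) (g : R -> R) (m a M : nat) :
  (2 <= m)%N ->
  totally_positive_finite_type g m ->
  continuous g ->
  (0 < a)%N -> (0 < M)%N ->
  let Sg : int -> R[i] := fun k => (g k%:~R)%:C in
  ((a%:R / M%:R : R) < 1 ->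
     is_frame (gabor Sg a M) /\
     exists gamma : int -> R[i],
       (exists N : nat, forall n : int, (N%:Z < `|n|)%R -> gamma n = 0) /\
       in_l2 gamma /\ dual_window Sg gamma a M) /\
  ((a%:R / M%:R : R) > 1 -> is_riesz_seq (gabor Sg a M)).
Proof.
move=> m2 tp cg a0 M0 Sg; have [[S S0 hS] dual] := tp_samples m2 tp cg.
have MR : 0 < M%:R :> R by rewrite ltr0n.
have thM (th : int -> R) (N0 : nat) : (forall y, N0%:Z < `|y| -> th y = 0) ->
    exists2 S' : R, 0 < S' & l1_bounded S' (fun k => th k / M%:R).
  move=> th0; have h := @finsupp_l1 R (fun k => th k / M%:R) N0.
  have {}h := h (fun y yN => etrans (congr1 (fun t => t / M%:R) (th0 y yN)) (mul0r _)).
  by exists (\sum_(n <- zrange N0) `|th n / M%:R| + 1);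
    [rewrite ltr_wpDl//; exact: l1_bounded_ge0 h|exact: l1_bounded_pos].
split=> aM.
  have aM' : (0 < a < M)%N by rewrite a0 -(ltr_nat R); move: aM; rewrite ltr_pdivrMr// mul1r.
  have [th [N0 [th0 thd]]] := dual a M aM'; have [S' S'0 thS] := thM th N0 th0.
  split; first by have [] := gabor_frames a0 M0 hS S0 thd thS S'0.
  exists (fun k => (th k / M%:R)%:C); split; last split.
  - by exists N0 => n /th0 ->; rewrite mul0r.
  - by apply: (l1_in_l2 thS) => n; exact: cabs_real.
  - exact: (gabor_dual_window a0 M0 hS S0 thd thS S'0).
have aM' : (0 < M < a)%N by rewrite M0 -(ltr_nat R); move: aM; rewrite ltr_pdivlMr// mul1r.
have [th [N0 [th0 thd]]] := dual M a aM'; have [S' S'0 thS] := thM th N0 th0.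
exact: (gabor_riesz a0 M0 hS S0 thd thS S'0).
Qed.
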